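(* Let $\mathfrak g_A=\mathbb Re_0\ltimes_A\mathfrak h$ be a $2n$-dimensional almost abelian Lie algebra and let $\mathfrak h=\mathfrak h_c\oplus\mathfrak h_s$ be a decomposition into $A$-invariant real subspaces with $\dim\mathfrak h_s=2(n-k)$, where $1\le k\le n$. Put $A_s=A|_{\mathfrak h_s}$. Then the following are equivalent: (i) there exists a closed $2$-form $\omega\in\bigwedge^2\mathfrak g_A^*$ whose restriction to $\mathfrak h_s$ is a non-degenerate form in $\bigwedge^2\mathfrak h_s^*$; (ii) $A_s\in\mathfrak{sp}(\mathfrak h_s,\sigma)$ for some symplectic form $\sigma$ on $\mathfrak h_s$, i.e. $\sigma(A_su,v)+\sigma(u,A_sv)=0$ for all $u,v\in\mathfrak h_s$; (iii) the real Jordan form of $A_s$ satisfies: (a) the blocks $\mathcal J_m(\lambda)$ with $\lambda\in\mathbb R\setminus\{0\}$ occur in matching pairs $\mathcal J_m(\lambda),\mathcal J_m(-\lambda)$; (b) the blocks $C_m(a,b)$ with $a\ne0$ and $b\ne0$ occur in matching pairs $C_m(a,b),C_m(-a,b)$; (c) the nilpotent blocks $\mathcal J_m(0)$ of odd size $m$ occur with even multiplicity. No condition is imposed on the blocks $C_m(0,b)$ with $b\ne0$.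
   Context: $\mathfrak g_A=\mathbb Re_0\ltimes_A\mathfrak h$ is the real Lie algebra with abelian ideal $\mathfrak h\cong\mathbb R^{2n-1}$ of codimension one and bracket $[e_0,v]=Av$ for $v\in\mathfrak h$. The differential on $\bigwedge^\bullet\mathfrak g_A^*$ is the derivation with $\mathrm d\xi(X,Y)=-\xi([X,Y])$ for $\xi\in\mathfrak g_A^*$. $\mathcal J_m(\lambda)$ is the $m\times m$ Jordan block with real eigenvalue $\lambda$; $C_m(a,b)$, $b\ne0$, is the $2m\times2m$ real Jordan block for the conjugate eigenvalue pair $a\pm\mathbf ib$, with $2\times 2$ diagonal blocks $\begin{pmatrix}a&-b\\ b&a\end{pmatrix}$ and identity $2\times2$ blocks on the superdiagonal. Blocks are taken up to real conjugation, so $C_m(a,b)$ and $C_m(a,-b)$ are identified. *)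

(* Defs.v *)
From HB Require Import structures.
From mathcomp Require Import all_boot all_order all_algebra.
From mathcomp Require Import sesquilinear.
From mathcomp Require Import ring.

Set Implicit Arguments.
Unset Strict Implicit.
Unset Printing Implicit Defensive.

Import GRing.Theory.
Local Open Scope ring_scope.

(* R e_0 |x_A h: the pair (s, u) stands for s e_0 + u. *)
Definition almost_abelian (R : fieldType) (h : vectType R) : vectType R :=
  (R^o * h)%type.

Definition aa_bracket (R : fieldType) (h : vectType R) (A : 'End(h))
    (X Y : almost_abelian h) : almost_abelian h :=
  (0, X.1 *: A Y.2 - Y.1 *: A X.2).

Definition aa_ideal (R : fieldType) (h : vectType R) (v : h) :
    almost_abelian h := (0, v).

Definition aa_e0 (R : fieldType) (h : vectType R) : almost_abelian h := (1, 0).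

Lemma aa_bracket_e0 (R : fieldType) (h : vectType R) (A : 'End(h)) (v : h) :
  aa_bracket A (aa_e0 h) (aa_ideal v) = aa_ideal (A v).
Proof. by rewrite /aa_bracket /= scale1r scale0r subr0. Qed.

Lemma aa_bracket_abelian (R : fieldType) (h : vectType R) (A : 'End(h))
  (u v : h) : aa_bracket A (aa_ideal u) (aa_ideal v) = 0.
Proof. by rewrite /aa_bracket /= !scale0r subr0. Qed.

Lemma aa_bracketxx (R : fieldType) (h : vectType R) (A : 'End(h))
  (X : almost_abelian h) : aa_bracket A X X = 0.
Proof. by rewrite /aa_bracket subrr. Qed.

Lemma aa_bracket_jacobi (R : fieldType) (h : vectType R) (A : 'End(h))
  (X Y Z : almost_abelian h) :
  aa_bracket A X (aa_bracket A Y Z) + aa_bracket A Y (aa_bracket A Z X)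
    + aa_bracket A Z (aa_bracket A X Y) = 0.
Proof.
rewrite /aa_bracket /= !scale0r !subr0 !linearB !linearZ /=.
apply: injective_projections; rewrite /= ?addr0 //.
case: X Y Z => [x u] [y v] [z w] /=.
rewrite !scalerN.
set a := y *: _; set b := x *: (z *: _); set c := z *: (y *: _).
by rewrite (addrC (a - b)) !addrA !subrK subrr.
Qed.

(* The Chevalley-Eilenberg differential of 1-forms and of 2-forms.  The latter *)
(* is the derivation extending the former, see [ce_d2_wedge].                  *)
Definition ce_d1 (R : fieldType) (h : vectType R) (A : 'End(h))
    (xi : almost_abelian h -> R) (X Y : almost_abelian h) : R :=
  - xi (aa_bracket A X Y).

Definition ce_d2 (R : fieldType) (h : vectType R) (A : 'End(h))
    (omega : almost_abelian h -> almost_abelian h -> R)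
    (X Y Z : almost_abelian h) : R :=
  - omega (aa_bracket A X Y) Z + omega (aa_bracket A X Z) Y
    - omega (aa_bracket A Y Z) X.

Definition wedge11 (R : fieldType) (V : vectType R) (xi eta : V -> R)
    (X Y : V) : R := xi X * eta Y - xi Y * eta X.

Definition wedge21 (R : fieldType) (V : vectType R) (alpha : V -> V -> R)
    (xi : V -> R) (X Y Z : V) : R :=
  alpha X Y * xi Z - alpha X Z * xi Y + alpha Y Z * xi X.

Definition wedge12 (R : fieldType) (V : vectType R) (xi : V -> R)
    (alpha : V -> V -> R) (X Y Z : V) : R :=
  xi X * alpha Y Z - xi Y * alpha X Z + xi Z * alpha X Y.

Lemma ce_d2_wedge (R : fieldType) (h : vectType R) (A : 'End(h))
  (xi eta : almost_abelian h -> R) (X Y Z : almost_abelian h) :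
  ce_d2 A (wedge11 xi eta) X Y Z =
    wedge21 (ce_d1 A xi) eta X Y Z - wedge12 xi (ce_d1 A eta) X Y Z.
Proof. by rewrite /ce_d2 /wedge11 /wedge21 /wedge12 /ce_d1; ring. Qed.

(* An element of \bigwedge^2 g^* is a skew-symmetric bilinear form; this is   *)
(* the same as an alternating one over the reals.                             *)
Definition ce_closed (R : fieldType) (h : vectType R) (A : 'End(h))
    (omega : {skew_symmetric (almost_abelian h)}) : Prop :=
  forall X Y Z, ce_d2 A omega X Y Z = 0.

Definition restr_form (R : fieldType) (h : vectType R)
    (omega : {skew_symmetric (almost_abelian h)}) (W : {vspace h})
    (u v : subvs_of W) : R :=
  omega (aa_ideal (vsval u)) (aa_ideal (vsval v)).

Lemma aa_ideal_linear (R : fieldType) (h : vectType R) :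
  linear (@aa_ideal R h).
Proof. by move=> a u v; apply: injective_projections; rewrite /= ?scaler0 ?addr0. Qed.

Lemma restr_form_bilinear (R : fieldType) (h : vectType R)
  (omega : {skew_symmetric (almost_abelian h)}) (W : {vspace h}) :
  bilinear_for *%R (idfun \; *%R) (@restr_form R h omega W).
Proof.
split=> [w|w] a u v; rewrite /restr_form linearP aa_ideal_linear.
  by rewrite linearPl.
by rewrite linearPr.
Qed.

HB.instance Definition _ (R : fieldType) (h : vectType R)
    (omega : {skew_symmetric (almost_abelian h)}) (W : {vspace h}) :=
  bilinear_isBilinear.Build R (subvs_of W) (subvs_of W) R *%R (idfun \; *%R)
    (@restr_form R h omega W) (restr_form_bilinear omega W).

Lemma restr_form_skew (R : fieldType) (h : vectType R)
  (omega : {skew_symmetric (almost_abelian h)}) (W : {vspace h})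
  (u v : subvs_of W) :
  restr_form omega u v = (-1) ^+ true * idfun (restr_form omega v u).
Proof. by rewrite /restr_form hermC. Qed.

HB.instance Definition _ (R : fieldType) (h : vectType R)
    (omega : {skew_symmetric (almost_abelian h)}) (W : {vspace h}) :=
  isHermitianSesquilinear.Build R (subvs_of W) true idfun
    (@restr_form R h omega W) (restr_form_skew (W := W) omega).

(* A restricted to W; the projection onto W only makes the codomain right,    *)
(* see [restr_endE].                                                          *)
Definition restr_end (R : fieldType) (h : vectType R) (A : 'End(h))
    (W : {vspace h}) : 'End(subvs_of W) :=
  linfun (vsproj W \o A \o vsval).

Lemma restr_endE (R : fieldType) (h : vectType R) (A : 'End(h))
  (W : {vspace h}) : (A @: W <= W)%VS ->
  forall u : subvs_of W, vsval (restr_end A W u) = A (vsval u).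
Proof.
move=> AW u; rewrite lfunE /= vsprojK //.
by apply: (subvP AW); rewrite memv_img ?subvsP.
Qed.

Definition in_sp (R : fieldType) (V : vectType R)
    (sigma : {skew_symmetric V}) (f : 'End(V)) : Prop :=
  forall u v : V, sigma (f u) v + sigma u (f v) = 0.

Inductive jblock (R : Type) : Type :=
| JReal of nat & R
| JComplex of nat & R & R.

Definition jblock_wf (R : fieldType) (B : jblock R) : bool :=
  match B with
  | JReal m _ => (0 < m)%N
  | JComplex m _ b => (0 < m)%N && (b != 0)
  end.

Definition jblock_dim (R : Type) (B : jblock R) : nat :=
  match B with
  | JReal m _ => m
  | JComplex m _ _ => \sum_(i < m) 2
  end.

Definition jreal_mx (R : fieldType) (m : nat) (lambda : R) : 'M[R]_m :=
  \matrix_(i, j) (if i == j then lambda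
                  else if i.+1 == j :> nat then 1 else 0).

Definition rot_mx (R : fieldType) (a b : R) : 'M[R]_2 :=
  \matrix_(i, j) (if i == j then a else if i == 0 then - b else b).

Definition jcomplex_mx (R : fieldType) (m : nat) (a b : R) :
    'M[R]_(\sum_(i < m) 2) :=
  \mxblock_(i < m, j < m) (if i == j then rot_mx a b
                           else if i.+1 == j :> nat then 1%:M else 0).

Definition jblock_mx (R : fieldType) (B : jblock R) : 'M[R]_(jblock_dim B) :=
  match B with
  | JReal m lambda => jreal_mx m lambda
  | JComplex m a b => jcomplex_mx m a b
  end.

Definition jordan_mx (R : fieldType) (s : seq (jblock R)) :
    'M[R]_(\sum_(i < size s) jblock_dim (tnth (in_tuple s) i)) :=
  \mxdiag_(i < size s) jblock_mx (tnth (in_tuple s) i).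

(* Coordinates are columns: the j-th column of M holds f e_j.  This is the    *)
(* transpose of [mxof], which acts on rows.                                   *)
Definition matrix_in_basis (R : fieldType) (V : vectType R) (n : nat)
    (e : n.-tuple V) (f : 'End(V)) (M : 'M[R]_n) : Prop :=
  basis_of fullv e /\ forall j, f (tnth e j) = \sum_i M i j *: tnth e i.

Definition real_jordan_form (R : fieldType) (V : vectType R) (f : 'End(V))
    (s : seq (jblock R)) : Prop :=
  all (@jblock_wf R) s /\ exists e, matrix_in_basis e f (jordan_mx s).

Definition mult_real (R : fieldType) (s : seq (jblock R)) (m : nat)
    (lambda : R) : nat :=
  count (fun B => if B is JReal m' l then (m' == m) && (l == lambda)
                  else false) s.

(* C_m(a, b) and C_m(a, - b) are identified. *)
Definition mult_complex (R : fieldType) (s : seq (jblock R)) (m : nat)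
    (a b : R) : nat :=
  count (fun B => if B is JComplex m' a' b'
                  then [&& m' == m, a' == a & (b' == b) || (b' == - b)]
                  else false) s.

(* Main.v *)
From HB Require Import structures.
Require Import Defs.
From mathcomp Require Import all_boot all_order all_algebra.
From mathcomp Require Import sesquilinear reals complex.
From mathcomp Require Import ring lra zify.

Set Implicit Arguments.
Unset Strict Implicit.
Unset Printing Implicit Defensive.

Import GRing.Theory Num.Theory.
Local Open Scope ring_scope.

(** Conditions (i) and (ii) say the same thing.  Evaluated on e_0, u, v, the
    closedness of a 2-form omega reads omega(Au, v) + omega(u, Av) = 0, so that
    the restriction of omega to h_s is an invariant symplectic form; in the
    other direction an invariant form on h_s is pulled back along the
    projection of g_A onto h_s with kernel R e_0 + h_c, which commutes with A
    on h.

    Invariance means that q(X) is adjoint to q(-X), where polynomials act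
    through the endomorphism ([form_pact]).  This drives both halves of the
    equivalence of (ii) and (iii).  A real Jordan block is a cyclic subspace,
    spanned by u, Au, A^2 u and so on, where u has annihilator p^m with p either
    X - l or (X - a)^2 + b^2 ([block_family], [family_block]); reflecting p
    into p(-X) turns the eigenvalue l into -l, and a + ib into -a - ib.

    From a form to the blocks ([nondeg_decomposition]): by induction on the
    dimension it suffices to split off a nonzero nondegenerate invariant
    subspace with known blocks, since its orthogonal complement is again
    nondegenerate and invariant.  For a prime p occurring in the space there
    are u killed by p^(m+1) and v killed by p(-X)^(m+1) such that p^m u is not
    orthogonal to v ([dual_generators]).  If p and p(-X) are coprime, u and v
    generate two isotropic cyclic spaces in duality, hence a matching pair of
    blocks.  Otherwise p is X or X^2 + b^2, and the form
    (x, y) |-> sigma(g x, y), with g = p^m or p^m X, is symmetric when g is odd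
    and alternating when g is even.  If an odd g is available, a vector that is
    not isotropic for this form generates a single nondegenerate block.  The
    remaining case, p = X with blocks of odd size m + 1, is alternating, and
    then two blocks have to be taken together.  Nondegeneracy always comes from
    [socle_mem]: a nonzero invariant subspace of a p-primary cyclic space
    contains the image of p^m.

    From the blocks to a form ([form_of_balanced]): the conditions of (iii)
    allow the blocks to be grouped into dual pairs and into self-dual blocks
    of even dimension.  If u has annihilator P of degree n and v has
    annihilator P(-X), then gu, hv |-> (coefficient of X^(n-1) in g(X) h(-X)
    modulo P) is an invariant perfect pairing; it is skew on a single
    self-dual block because n is even. *)

(** * Polynomials acting through an endomorphism, cyclic subspaces *)

Section PolynomialAction.
Variables (F : fieldType) (V : vectType F) (f : 'End(V)).
Implicit Types (p q : {poly F}) (u x : V) (U Z : {vspace V}).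

(** The action of q(f).  It is a function of the vector rather than an element
    of the endomorphism algebra, which is a ring only for nonzero spaces. *)
Definition pact q x : V := \sum_(i < size q) q`_i *: iter i f x.

Lemma pact_wide n q x :
  (size q <= n)%N -> pact q x = \sum_(i < n) q`_i *: iter i f x.
Proof.
move=> le_n; rewrite /pact (big_ord_widen n (fun i => q`_i *: iter i f x)) //.
rewrite big_mkcond; apply: eq_bigr => i _; case: ltnP => // /(nth_default 0) ->.
by rewrite scale0r.
Qed.

Fact pact_is_linear q : linear (pact q).
Proof.
move=> a x y; rewrite /pact scaler_sumr -big_split; apply: eq_bigr => i _ /=.
have ->: iter i f (a *: x + y) = a *: iter i f x + iter i f y.
  by elim: (nat_of_ord i) => //= k ->; rewrite linearP.
by rewrite scalerDr !scalerA [_ * a]mulrC.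
Qed.
HB.instance Definition _ q :=
  GRing.isLinear.Build F V V *:%R (pact q) (pact_is_linear q).

Lemma pactD p q x : pact (p + q) x = pact p x + pact q x.
Proof.
pose n := maxn (size p) (size q).
rewrite !(@pact_wide n) ?leq_maxl ?leq_maxr ?size_polyD //.
rewrite -big_split; apply: eq_bigr => i _ /=; by rewrite coefD scalerDl.
Qed.

Lemma pactZ a q x : pact (a *: q) x = a *: pact q x.
Proof.
rewrite (@pact_wide (size q)) ?size_scale_leq // scaler_sumr.
by apply: eq_bigr => i _; rewrite coefZ scalerA.
Qed.

Lemma pact0 x : pact 0 x = 0.
Proof. by rewrite /pact size_poly0 big_ord0. Qed.

Lemma pactN q x : pact (- q) x = - pact q x.
Proof. by rewrite -scaleN1r pactZ scaleN1r. Qed.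

Lemma pactB p q x : pact (p - q) x = pact p x - pact q x.
Proof. by rewrite pactD pactN. Qed.

Lemma pactXn n x : pact 'X^n x = iter n f x.
Proof.
rewrite /pact size_polyXn big_ord_recr /= coefXn eqxx scale1r.
rewrite big1 ?add0r // => i _; rewrite coefXn [_ == n]ltn_eqF ?scale0r //=.
Qed.

Lemma pactX x : pact 'X x = f x.
Proof. by rewrite -['X]expr1 pactXn. Qed.

Lemma pact1 x : pact 1 x = x.
Proof. by rewrite -(expr0 'X) pactXn. Qed.

Lemma pactC a x : pact a%:P x = a *: x.
Proof. by rewrite -[a%:P]mulr1 mul_polyC pactZ pact1. Qed.

Lemma pactXM q x : pact ('X * q) x = f (pact q x).
Proof.
rewrite (@pact_wide (size q).+1); last first.
  by rewrite (leq_trans (size_polyMleq _ _)) // size_polyX.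
rewrite big_ord_recl coefXM scale0r add0r linear_sum; apply: eq_bigr => i _.
by rewrite coefXM /= linearZ.
Qed.

Lemma pactM p q x : pact (p * q) x = pact p (pact q x).
Proof.
elim/poly_ind: p => [|p c IH]; first by rewrite mul0r !pact0.
rewrite mulrDl !pactD mul_polyC pactZ mulrAC mulrC pactXM IH.
by rewrite mulrC pactXM pactC.
Qed.

Lemma pact_comm p q x : pact p (pact q x) = pact q (pact p x).
Proof. by rewrite -!pactM mulrC. Qed.

Definition stable U := forall x, x \in U -> f x \in U.

Lemma limg_stable U : (f @: U <= U)%VS <-> stable U.
Proof.
split=> [/subvP fU x xU|fU]; first by rewrite fU ?memv_img.
by apply/subvP => _ /memv_imgP[x xU ->]; apply: fU.
Qed.

Lemma pact_stable U q x : stable U -> x \in U -> pact q x \in U.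
Proof.
move=> fU xU; apply: memv_suml => i _; apply: memvZ.
by elim: (nat_of_ord i) => //= k; apply: fU.
Qed.

Lemma stableD U W : stable U -> stable W -> stable (U + W)%VS.
Proof.
by move=> sU sW _ /memv_addP[x xU [y yW ->]]; rewrite linearD memv_add ?sU ?sW.
Qed.

Lemma stableI U W : stable U -> stable W -> stable (U :&: W)%VS.
Proof.
by move=> sU sW x; rewrite !memv_cap => /andP[xU xW]; rewrite sU ?sW.
Qed.

Lemma pact_dvd p q x : p %| q -> pact p x = 0 -> pact q x = 0.
Proof. by case/dvdpP=> r -> px; rewrite pactM px linear0. Qed.

(** When u is killed by a polynomial of degree n this is the whole cyclic
    subspace generated by u; the length n keeps track of the dimension. *)
Definition cyc n u : {vspace V} := <<mkseq (fun i => iter i f u) n>>%VS.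

Lemma cycP n u x :
  reflect (exists2 q : {poly F}, (size q <= n)%N & x = pact q u)
          (x \in cyc n u).
Proof.
apply: (iffP idP) => [|[q le_q ->]]; last first.
  rewrite (pact_wide _ le_q); apply: memv_suml => i _.
  apply/rpredZ/memv_span.
  by apply/mapP; exists (i : nat); rewrite ?mem_iota ?ltn_ord.
set X := [tuple of mkseq (fun i => iter i f u) n].
rewrite /cyc -/(tval X) => /coord_span ->.
exists (\poly_(i < n) (if insub i is Some j then coord X j x else 0)).
  exact: size_poly.
rewrite (@pact_wide n) ?size_poly //; apply: eq_bigr => i _.
by rewrite coef_poly ltn_ord valK nth_mkseq.
Qed.

Lemma dim_cyc_le n u : (\dim (cyc n u) <= n)%N.
Proof. by rewrite (leq_trans (dim_span _)) ?size_mkseq. Qed.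

Lemma pact_mod p q u : p != 0 -> pact p u = 0 -> pact q u = pact (q %% p) u.
Proof.
by move=> p0 pu; rewrite {1}(divp_eq q p) pactD pactM pu linear0 add0r.
Qed.

Lemma mem_cyc p n u q :
  size p = n.+1 -> pact p u = 0 -> pact q u \in cyc n u.
Proof.
move=> sz_p pu; have p0: p != 0 by rewrite -size_poly_eq0 sz_p.
rewrite (pact_mod _ p0) //; apply/cycP; exists (q %% p) => //.
by rewrite -ltnS -sz_p ltn_modp.
Qed.

Lemma cyc_stable p n u :
  size p = n.+1 -> pact p u = 0 -> stable (cyc n u).
Proof.
move=> sz_p pu _ /cycP[q _ ->]; rewrite -pactXM; exact: mem_cyc pu.
Qed.

Lemma cyc_sub n u U : stable U -> u \in U -> (cyc n u <= U)%VS.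
Proof. by move=> sU uU; apply/subvP => _ /cycP[q _ ->]; apply: pact_stable. Qed.

(** Maximal dimension of the cyclic space means that no polynomial of degree
    less than n kills u, so a remainder modulo p that kills u vanishes. *)
Lemma cyc_full_dvd p n u q : size p = n.+1 -> pact p u = 0 ->
  \dim (cyc n u) = n -> pact q u = 0 -> p %| q.
Proof.
move=> sz_p pu dim_c qu; have p0: p != 0 by rewrite -size_poly_eq0 sz_p.
have fr: free (mkseq (fun i => iter i f u) n) by rewrite /free dim_c size_mkseq.
have {fr}: free [tuple of mkseq (fun i => iter i f u) n] by [].
move/freeP=> fr; apply/eqP/polyP => i; rewrite coef0.
case: (ltnP i n) => [lt_i|le_n]; last first.
  by rewrite nth_default // (leq_trans _ le_n) // -ltnS -sz_p ltn_modp.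
have sz_r: (size (q %% p)%R <= n)%N by rewrite -ltnS -sz_p ltn_modp.
apply: (fr (fun j : 'I_n => (q %% p)`_j) _ (Ordinal lt_i)).
rewrite -[RHS]qu (pact_mod _ p0) // (pact_wide _ sz_r).
by apply: eq_bigr => j _; rewrite nth_mkseq.
Qed.

Lemma dim_cyc_full p n u : size p = n.+1 ->
  (forall q, pact q u = 0 -> p %| q) -> \dim (cyc n u) = n.
Proof.
move=> sz_p ann; suff: free [tuple of mkseq (fun i => iter i f u) n].
  by move/eqP=> dim_X; apply: etrans dim_X (size_mkseq _ _).
apply/freeP => k sum0 i.
pose q := \poly_(j < n) (if insub j is Some j' then k j' else 0).
have sz_q : (size q <= n)%N by exact: size_poly.
have qi : q`_i = k i by rewrite coef_poly ltn_ord valK.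
have q0: q = 0.
  apply: contraTeq (ann q _) => [q_n0|]; last first.
    rewrite (pact_wide _ sz_q) -[RHS]sum0; apply: eq_bigr => j _.
    by rewrite coef_poly ltn_ord valK nth_mkseq.
  by apply: contraTN sz_q => /(dvdp_leq q_n0); rewrite sz_p ltnNge.
by rewrite -qi q0 coef0.
Qed.

(** A p-primary cyclic module is uniserial: if q is prime to p, then u itself
    is recovered from q u by Bezout; otherwise one factor p of q is moved onto u
    and the exponent drops.  With Z = 0 it computes annihilators, with Z an
    orthogonal complement it yields nondegeneracy. *)
Lemma socle_mem p m u Z q : irreducible_poly p -> stable Z ->
  pact (p ^+ m.+1) u = 0 -> pact q u \in Z -> ~~ (p ^+ m.+1 %| q) ->
  pact (p ^+ m) u \in Z.
Proof.
move=> irr sZ.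
have coprime_gen w g k : pact (p ^+ k) w = 0 -> pact g w \in Z ->
    ~~ (p %| g) -> w \in Z.
  move=> pw gw; rewrite -irreducible_poly_coprime // => cop.
  have /Bezout_eq1_coprimepP[[a b] /= ab1] := coprimep_expl k cop.
  by rewrite -[w]pact1 -ab1 pactD !pactM pw linear0 add0r pact_stable.
move=> pu qu ndvd.
elim: m u q pu qu ndvd => [|m IH] u q pu qu ndvd.
all: have [p_q|np_q] := boolP (p %| q).
- by rewrite expr1 p_q in ndvd.
- by apply: pact_stable => //; apply: coprime_gen pu qu _.
- case/dvdpP: p_q => q' def_q.
  rewrite exprSr pactM; apply: (IH _ q').
  + by rewrite -pactM -exprSr.
  + by rewrite -pactM -def_q.
  + by move: ndvd; rewrite def_q [p ^+ m.+2]exprSr dvdp_mul2r // irredp_neq0.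
- by apply: pact_stable => //; apply: coprime_gen pu qu _.
Qed.

End PolynomialAction.

(** * The reflection of polynomials and adjoints *)

Section Reflection.
Variable F : fieldType.
Implicit Types p q : {poly F}.

(** The polynomial q(-X), which acts as the adjoint of q(X). *)
Definition prefl q := q \Po (- 'X).

Fact prefl_is_linear : linear prefl.
Proof. by move=> a p q; rewrite /prefl comp_polyD comp_polyZ. Qed.
HB.instance Definition _ :=
  GRing.isLinear.Build F {poly F} {poly F} *:%R prefl prefl_is_linear.
Fact prefl_is_monoid : monoid_morphism prefl.
Proof. by split=> [|p q]; rewrite /prefl ?comp_polyM // -polyC1 comp_polyC. Qed.
HB.instance Definition _ :=
  GRing.isMonoidMorphism.Build {poly F} {poly F} prefl prefl_is_monoid.

Lemma preflC c : prefl c%:P = c%:P.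
Proof. exact: comp_polyC. Qed.

Lemma preflX : prefl 'X = - 'X.
Proof. exact: comp_polyX. Qed.

Lemma preflK : involutive prefl.
Proof.
by move=> q; rewrite /prefl -comp_polyA rmorphN /= comp_polyX opprK comp_polyXr.
Qed.

Lemma size_prefl q : size (prefl q) = size q.
Proof. by rewrite /prefl size_comp_poly2 // size_polyN size_polyX. Qed.

Lemma coef_prefl q i : (prefl q)`_i = (-1) ^+ i * q`_i.
Proof.
elim/poly_ind: q i => [|q c IH] i; first by rewrite linear0 coef0 mulr0.
rewrite linearD rmorphM /= preflX preflC mulrN !coefD coefN !coefMX !coefC.
case: i => [|i] /=; rewrite ?oppr0 ?expr0 ?mul1r // IH exprS.
by rewrite mulN1r mulNr !addr0.
Qed.

Lemma prefl_dvd p q : (prefl p %| prefl q) = (p %| q).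
Proof.
have imp p' q' : p' %| q' -> prefl p' %| prefl q'.
  by case/dvdpP=> r ->; rewrite rmorphM dvdp_mulIr.
by apply/idP/idP=> /imp //; rewrite !preflK.
Qed.

Lemma prefl_irreducible p : irreducible_poly p -> irreducible_poly (prefl p).
Proof.
case=> sz_p irr; split=> [|q sz_q q_p]; first by rewrite size_prefl.
rewrite -[q]preflK /eqp !prefl_dvd; apply: irr; first by rewrite size_prefl.
by rewrite -prefl_dvd preflK.
Qed.

End Reflection.

Section Invariant.
Variables (F : fieldType) (V : vectType F) (f : 'End(V)).
Variable sg : {skew_symmetric V}.
Hypothesis sp : in_sp sg f.
Implicit Types (p q : {poly F}) (u v x y : V) (U W Z : {vspace V}).

Lemma skewC x y : sg x y = - sg y x.
Proof. by rewrite hermC expr1 mulN1r. Qed.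

Lemma form_pact q x y : sg (pact f q x) y = sg x (pact f (prefl q) y).
Proof.
elim/poly_ind: q x => [|q c IH] x.
  by rewrite linear0 !pact0 linear0l linear0r.
rewrite linearD rmorphM /= preflX preflC !pactD !pactM !pactC.
rewrite !linearDl !linearDr /=.
rewrite IH linearZl_LR linearZr_LR /= pactN !pactX; congr (_ + _).
rewrite linearN linearNr /= -(pactX f y) pact_comm pactX; apply/eqP.
by rewrite -addr_eq0 sp.
Qed.

Lemma form_adj q x y : sg x (pact f q y) = sg (pact f (prefl q) x) y.
Proof. by rewrite form_pact preflK. Qed.

Lemma orthov_stable U : stable f U -> stable f (orthov sg U).
Proof.
move=> sU x /mem_orthovP xU; apply/mem_orthovP => y yU.
by have := sp x y; rewrite (xU _ (sU _ yU)) addr0.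
Qed.

Definition nondeg U := (U :&: orthov sg U = 0)%VS.

Lemma nondegP U : nondeg U <->
  (forall x, x \in U -> (forall y, y \in U -> sg x y = 0) -> x = 0).
Proof.
split=> [nU x xU xo|nU].
  by apply/eqP; rewrite -memv0 -nU memv_cap xU; apply/mem_orthovP.
apply/eqP; rewrite -subv0; apply/subvP => x; rewrite memv_cap memv0.
by case/andP=> xU /mem_orthovP xo; apply/eqP/nU.
Qed.

(** Orthogonality to W amounts to dim W linear equations. *)
Lemma dim_cap_orthov U W :
  (\dim U <= \dim (U :&: orthov sg W) + \dim W)%N.
Proof.
pose phi x : 'rV[F]_(\dim W) := \row_i sg x (vbasis W)`_i.
have phi_lin : linear phi.
  by move=> a x y; apply/rowP => i; rewrite !mxE linearPl.
pose phiL := GRing.isLinear.Build _ _ _ _ phi phi_lin.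
pose g : 'Hom(V, 'rV[F]_(\dim W)) :=
  linfun (HB.pack_for {linear _ -> _} phi phiL).
rewrite -(limg_ker_dim g U) leq_add //; last first.
  by rewrite (leq_trans (dimvS (subvf _))) // dimvf /dim /= mul1n.
apply/dimvS/capvS => //; apply/subvP => x; rewrite memv_ker lfunE /= => /eqP gx.
apply/mem_orthovP => y /coord_vbasis ->; rewrite linear_sumr big1 // => i _.
by have /rowP/(_ i) := gx; rewrite !mxE linearZr_LR /= => ->; rewrite mulr0.
Qed.

Lemma nondeg_split U W : (W <= U)%VS -> nondeg U -> nondeg W ->
  [/\ (W :&: (U :&: orthov sg W) = 0)%VS, (W + (U :&: orthov sg W) = U)%VS
    & nondeg (U :&: orthov sg W)].
Proof.
move=> WU nU nW; set W' := (U :&: _)%VS.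
have cap0 : (W :&: W' = 0)%VS.
  by rewrite /W' capvA (capv_idPl WU) nW.
have sumU : (W + W' = U)%VS.
  apply/eqP; rewrite eqEdim subv_add WU capvSl /=.
  by rewrite dimv_disjoint_sum // addnC dim_cap_orthov.
split=> //; apply/nondegP => x xW' xo.
have /nondegP nU' := nU; apply: nU'.
  by move: xW'; rewrite memv_cap => /andP[].
rewrite -sumU => _ /memv_addP[y yW [z zW' ->]].
rewrite linearDr /= (xo z) // addr0.
by move: xW'; rewrite memv_cap => /andP[_ /mem_orthovP]; apply.
Qed.

(** With u := r x0, Bezout gives p^m u = p^m b r u for some b, so moving b r to
    the other side of the form replaces a vector y that is not orthogonal to
    p^m u by the vector v = (b r)(-X) y; the latter is killed by p(-X)^(m+1)
    since (p^(m+1) r)(-X) kills U, being adjoint to p^(m+1) r. *)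
Lemma dual_generators U p m r x0 :
  irreducible_poly p -> ~~ (p %| r) -> stable f U -> nondeg U ->
  {in U, forall x, pact f (p ^+ m.+1 * r) x = 0} -> x0 \in U ->
  pact f (p ^+ m * r) x0 != 0 ->
  exists u v, [/\ u \in U, v \in U, pact f (p ^+ m.+1) u = 0,
    pact f (prefl p ^+ m.+1) v = 0 & sg (pact f (p ^+ m) u) v != 0].
Proof.
move=> irr; rewrite -irreducible_poly_coprime // => cop sU nU ann x0U nz.
have /Bezout_eq1_coprimepP[[a b] /= ab1] := coprimep_expl m.+1 cop.
set u := pact f r x0; have uU : u \in U by apply: pact_stable.
have pu : pact f (p ^+ m.+1) u = 0 by rewrite -pactM ann.
have [y yU nzy] : exists2 y, y \in U & sg (pact f (p ^+ m) u) y != 0.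
  have : pact f (p ^+ m) u \notin orthov sg U.
    apply: contra nz; rewrite pactM -/u -memv0 -nU memv_cap => ->.
    by rewrite pact_stable.
  by case/mem_orthovPn=> y yU nzy; exists y.
exists u, (pact f (prefl (b * r)) y); split=> //; first exact: pact_stable.
  rewrite -rmorphXn -pactM -rmorphM mulrCA rmorphM pactM.
  rewrite (_ : pact f (prefl (p ^+ m.+1 * r)) y = 0) ?linear0 //.
  have /nondegP nU' := nU; apply: nU'; first exact: pact_stable.
  by move=> z zU; rewrite form_pact preflK ann // linear0r.
rewrite -form_pact -pact_comm -[X in sg (pact f _ X) _](_ : u = _) //.
by rewrite -[LHS](pact1 f) -ab1 pactD pactM pu linear0 add0r.
Qed.

(** By coprimality p(-X)^(m+1) is invertible on vectors killed by p^(m+1), and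
    it can be moved across the form, where it becomes p^(m+1). *)
Lemma isotropic_cyc p m n u :
  coprimep p (prefl p) -> pact f (p ^+ m.+1) u = 0 ->
  {in cyc f n u &, forall x y, sg x y = 0}.
Proof.
move=> cop pu _ _ /cycP[g _ ->] /cycP[h _ ->].
have /(coprimep_expl m.+1)/(coprimep_expr m.+1) := cop.
case/Bezout_eq1_coprimepP=> -[a b] /= ab1.
rewrite -[pact f h u](pact1 f) -ab1 pactD !pactM.
rewrite [pact f (p ^+ _) _]pact_comm pu !linear0 add0r.
rewrite pact_comm form_adj rmorphXn /= preflK -pactM mulrC pactM pu.
by rewrite linear0 linear0l.
Qed.

Section Blocks.
Variables (p : {poly F}) (m : nat).
Hypothesis irr : irreducible_poly p.
Let N := (size (p ^+ m.+1)).-1.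

Let sz_pm q : irreducible_poly q -> (size (q ^+ m.+1)).-1.+1 = size (q ^+ m.+1).
Proof.
by move=> /irredp_neq0 q0; rewrite prednK // size_poly_gt0 expf_neq0.
Qed.

Lemma dim_cyc_irr u : pact f (p ^+ m.+1) u = 0 -> pact f (p ^+ m) u != 0 ->
  \dim (cyc f N u) = N.
Proof.
move=> pu pmu; apply: (dim_cyc_full (esym (sz_pm irr))) => q qu.
apply: contraNT pmu => ndvd; rewrite -memv0.
apply: (socle_mem irr (q := q)) => //; last by rewrite qu mem0v.
by move=> x; rewrite !memv0 => /eqP->; rewrite linear0.
Qed.

(** A nonzero vector of the radical would put p^m u, hence q p^m u, into the
    radical. *)
Lemma nondeg_cyc q u : pact f (p ^+ m.+1) u = 0 ->
  sg (pact f (p ^+ m) (pact f q u)) u != 0 -> nondeg (cyc f N u).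
Proof.
move=> pu nz; have sW : stable f (cyc f N u).
  by apply: cyc_stable pu; rewrite sz_pm.
apply/nondegP => x xW xo; apply/eqP; apply: contraNT nz => x0.
have /cycP[g _ def_x] := xW.
have := mem_cyc 1 (esym (sz_pm irr)) pu; rewrite pact1 => uW.
have : pact f (p ^+ m) u \in orthov sg (cyc f N u).
  apply: (socle_mem irr (q := g)) => //; first exact: orthov_stable.
    by rewrite -def_x; apply/mem_orthovP.
  by apply: contra x0 => /pact_dvd/(_ pu); rewrite def_x => ->.
move=> pmuo; have : pact f q (pact f (p ^+ m) u) \in orthov sg (cyc f N u).
  by apply: pact_stable => //; apply: orthov_stable.
by rewrite pact_comm => /mem_orthovP ->.
Qed.

(** Both cyclic spaces are isotropic, so a vector of the radical has both of its
    components orthogonal to the opposite cyclic space; by [socle_mem] a nonzero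
    component would put p^m u or p(-X)^m v there as well. *)
Lemma nondeg_cyc_pair u v : coprimep p (prefl p) -> pact f (p ^+ m.+1) u = 0 ->
  pact f (prefl p ^+ m.+1) v = 0 -> sg (pact f (p ^+ m) u) v != 0 ->
  (cyc f N u :&: cyc f N v = 0)%VS /\ nondeg (cyc f N u + cyc f N v).
Proof.
move=> cop pu pv nz; have irr' := prefl_irreducible irr.
have szN : size (prefl p ^+ m.+1) = N.+1.
  by rewrite -rmorphXn size_prefl sz_pm.
have sU : stable f (cyc f N u) by apply: cyc_stable pu; rewrite sz_pm.
have sV : stable f (cyc f N v) by apply: cyc_stable pv.
have := mem_cyc 1 (esym (sz_pm irr)) pu; rewrite pact1 => uU.
have := mem_cyc 1 szN pv; rewrite pact1 => vV.
have isoU : {in cyc f N u &, forall x y, sg x y = 0}.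
  exact: isotropic_cyc pu.
have isoV : {in cyc f N v &, forall x y, sg x y = 0}.
  by apply: isotropic_cyc pv; rewrite preflK coprimep_sym.
have orthU x : x \in cyc f N u -> x \in orthov sg (cyc f N v) -> x = 0.
  case/cycP=> g _ -> xo; apply/eqP; apply: contraNT nz => x0.
  have /mem_orthovP -> // : pact f (p ^+ m) u \in orthov sg (cyc f N v).
  apply: (socle_mem irr (q := g)) => //; first exact: orthov_stable.
  by apply: contra x0 => /pact_dvd/(_ pu) ->.
have orthV x : x \in cyc f N v -> x \in orthov sg (cyc f N u) -> x = 0.
  case/cycP=> g _ -> xo; apply/eqP; apply: contraNT nz => x0.
  rewrite form_pact rmorphXn /= skewC oppr_eq0.
  have /mem_orthovP -> // : pact f (prefl p ^+ m) v \in orthov sg (cyc f N u).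
  apply: (socle_mem irr' (q := g)) => //; first exact: orthov_stable.
  by apply: contra x0 => /pact_dvd/(_ pv) ->.
split.
  apply/eqP; rewrite -subv0; apply/subvP => x; rewrite memv_cap memv0.
  case/andP=> xU xV; apply/eqP/orthU => //.
  by apply/mem_orthovP => y; apply: isoV.
apply/nondegP => _ /memv_addP[x xU [y yV ->]] xo.
have x0 : x = 0.
  apply: orthU => //; apply/mem_orthovP => z zV.
  have := xo z (subvP (addvSr _ _) _ zV).
  by rewrite linearDl /= (isoV y z) ?addr0.
have y0 : y = 0.
  apply: orthV => //; apply/mem_orthovP => z zU.
  have := xo z (subvP (addvSl _ _) _ zU).
  by rewrite linearDl /= (isoU x z) ?add0r.
by rewrite x0 y0 addr0.
Qed.

End Blocks.

End Invariant.

(** * Self-dual prime factors *)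

Section SelfDual.
Variables (F : fieldType) (V : vectType F) (f : 'End(V)).
Variable sg : {skew_symmetric V}.
Hypothesis sp : in_sp sg f.
Hypothesis two_neq0 : (2 : F) != 0.
Implicit Types (p q g h : {poly F}) (u v x y : V) (U W Z : {vspace V}).

Lemma selfdual_symm g x y : prefl g = - g ->
  sg (pact f g x) y = sg (pact f g y) x.
Proof.
by move=> gN; rewrite form_pact // gN pactN linearNr /= skewC opprK.
Qed.

Lemma selfdual_alt g x : prefl g = g -> sg (pact f g x) x = 0.
Proof.
move=> gE; have : sg (pact f g x) x = - sg (pact f g x) x.
  by rewrite {1}form_pact // gE skewC.
move/eqP; rewrite -addr_eq0 -mulr2n -mulr_natl mulf_eq0 (negPf two_neq0) /=.
by move/eqP.
Qed.

(** Polarization: a symmetric form vanishing on x, y and x + y vanishes at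
    (x, y). *)
Lemma symm_nonisotropic U g x y : prefl g = - g -> x \in U -> y \in U ->
  sg (pact f g x) y != 0 -> exists2 w, w \in U & sg (pact f g w) w != 0.
Proof.
move=> gN xU yU nz.
have [x0|] := eqVneq (sg (pact f g x) x) 0; last by exists x.
have [y0|] := eqVneq (sg (pact f g y) y) 0; last by exists y.
exists (x + y); first exact: memvD.
rewrite [pact f g _]linearD linearDl !linearDr /= x0 y0.
rewrite (selfdual_symm y x gN) add0r addr0.
by rewrite -mulr2n -mulr_natl mulf_neq0.
Qed.

(** The two-generator analogue of [socle_mem] for p = X: after factoring out the
    largest common power X^k of g and h, applying X^(m-k) leaves a combination
    of X^m u and X^m v with the constant terms of the quotients as coefficients. *)
Lemma nil_pair_indep Z m u v g h : stable f Z ->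
  pact f 'X^(m.+1) u = 0 -> pact f 'X^(m.+1) v = 0 ->
  (forall c d, pact f 'X^m (c *: u + d *: v) \in Z -> c = 0 /\ d = 0) ->
  pact f g u + pact f h v \in Z -> pact f g u = 0 /\ pact f h v = 0.
Proof.
move=> sZ pu pv indep ghZ.
suff dvd k : (k <= m.+1)%N -> 'X^k %| g /\ 'X^k %| h.
  by have [//|dg dh] := dvd m.+1; rewrite (pact_dvd dg pu) (pact_dvd dh pv).
elim: k => [|k IH] lt_k; first by rewrite expr0 !dvd1p.
have [/dvdpP[g' def_g] /dvdpP[h' def_h]] := IH (ltnW lt_k).
have head q w : pact f 'X^(m.+1) w = 0 ->
    pact f 'X^(m - k) (pact f (q * 'X^k) w) = q`_0 *: pact f 'X^m w.
  move=> pw; rewrite -pactM mulrCA -exprD subnK // pactM.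
  elim/poly_ind: q => [|q c _]; first by rewrite pact0 coef0 scale0r.
  rewrite pactD pactM pactC -[pact f 'X _]pactM -exprS pw linear0 add0r.
  by rewrite coefD coefMX coefC add0r.
have [] := indep g'`_0 h'`_0.
  rewrite linearD !linearZ /= -!head // -linearD -def_g -def_h.
  exact: pact_stable.
have dvdX q : q`_0 = 0 -> 'X^(k.+1) %| q * 'X^k.
  move=> q0; rewrite exprS dvdp_mul2r ?expf_neq0 ?polyX_eq0 //.
  by rewrite -['X]subr0 -polyC0 dvdp_XsubCl rootE horner_coef0 q0.
by rewrite def_g def_h => /dvdX -> /dvdX ->.
Qed.

(** As m is even, the form (x, y) |-> sigma(X^m x, y) is alternating, so X^m u
    pairs nontrivially with v only and X^m v with u only; hence no nonzero
    combination of them is orthogonal to both u and v. *)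
Lemma nondeg_nil_pair m u v : ~~ odd m ->
  pact f 'X^(m.+1) u = 0 -> pact f 'X^(m.+1) v = 0 ->
  sg (pact f 'X^m u) v != 0 ->
  (cyc f m.+1 u :&: cyc f m.+1 v = 0)%VS
    /\ nondeg sg (cyc f m.+1 u + cyc f m.+1 v).
Proof.
move=> m_even pu pv nz.
have szX : size ('X^(m.+1) : {poly F}) = m.+2 by rewrite size_polyXn.
have selfX : prefl ('X^m : {poly F}) = 'X^m.
  by rewrite rmorphXn /= preflX exprNn -signr_odd (negPf m_even) mul1r.
have sU := cyc_stable szX pu; have sV := cyc_stable szX pv.
have := mem_cyc 1 szX pu; rewrite pact1 => uU.
have := mem_cyc 1 szX pv; rewrite pact1 => vV.
set W := (_ + _)%VS; have uW : u \in W := subvP (addvSl _ _) _ uU.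
have vW : v \in W := subvP (addvSr _ _) _ vV.
have indep c d :
    pact f 'X^m (c *: u + d *: v) \in orthov sg W -> c = 0 /\ d = 0.
  rewrite linearD !linearZ /= => /mem_orthovP wo; split.
    have := wo v vW.
    rewrite linearDl !linearZl_LR /= selfdual_alt // mulr0 addr0.
    by move/eqP; rewrite mulf_eq0 (negPf nz) orbF => /eqP.
  have := wo u uW.
  rewrite linearDl !linearZl_LR /= selfdual_alt // mulr0 add0r => /eqP.
  rewrite mulf_eq0 [sg _ _]form_pact // selfX skewC oppr_eq0 (negPf nz).
  by rewrite orbF => /eqP.
have sW : stable f (orthov sg W) by apply: orthov_stable => //; apply: stableD.
have nil := nil_pair_indep sW pu pv indep.
split.
  apply/eqP; rewrite -subv0; apply/subvP => x; rewrite memv_cap memv0.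
  case/andP=> /cycP[g _ ->] /cycP[h _ def_h].
  have [|-> //] := nil g (- h); by rewrite pactN def_h subrr mem0v.
apply/nondegP => _ /memv_addP[_ /cycP[g _ ->] [_ /cycP[h _ ->] ->]] xo.
have [|-> ->] := nil g h; last by rewrite addr0.
exact/mem_orthovP.
Qed.

End SelfDual.

(** * Annihilating polynomials *)

Section Annihilator.
Variables (F : fieldType) (V : vectType F) (f : 'End(V)).

(** The first n iterates of x cannot remain independent once n exceeds the
    dimension. *)
Lemma vector_annihilator (x : V) :
  exists2 q : {poly F}, q != 0 & pact f q x = 0.
Proof.
pose X n := mkseq (fun i => iter i f x) n.
have alt n : free (X n) \/ exists2 q : {poly F}, q != 0 & pact f q x = 0.
  elim: n => [|n [frX|]]; [by left; apply: nil_free | | by right].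
  have [x_in|x_out] := boolP (iter n f x \in <<X n>>%VS); last first.
    left; rewrite /X mkseqS (perm_free (permEl (perm_rcons _ _))).
    by rewrite free_cons x_out.
  right; have /cycP[q sz_q def_x] : iter n f x \in cyc f n x by [].
  (* The first dependent iterate is a combination of the earlier ones. *)
  exists ('X^n - q); last by rewrite pactB pactXn def_x subrr.
  apply/eqP => /(congr1 (coefp n)); rewrite /= coefB coefXn eqxx nth_default //.
  by rewrite subr0 coef0; apply/eqP/oner_neq0.
case: (alt (dim V).+1) => //; rewrite /free size_mkseq => /eqP dimX.
by have := dimvS (subvf <<X (dim V).+1>>); rewrite dimX dimvf ltnn.
Qed.

Lemma annihilator : exists2 q : {poly F}, q != 0 & forall x, pact f q x = 0.
Proof.
suff [q q0 ann] : exists2 q : {poly F}, q != 0 &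
    {in (vbasis {:V} : seq V), forall x, pact f q x = 0}.
  exists q => // x; rewrite (coord_vbasis (memvf x)) linear_sum big1 // => i _.
  by rewrite linearZ /= ann ?scaler0 ?mem_nth ?size_tuple.
elim: (vbasis _ : seq V) => [|x s [q q0 ann]].
  by exists 1; rewrite ?oner_neq0.
have [r r0 rx] := vector_annihilator x.
exists (q * r) => [|y]; first exact: mulf_neq0.
rewrite inE => /predU1P[->|ys]; first by rewrite pactM rx linear0.
by rewrite mulrC pactM ann ?linear0.
Qed.

End Annihilator.

(** * Jordan blocks and their polynomials *)

Section BlockPolynomials.
Variable F : fieldType.
Implicit Types (B : jblock F) (s : seq (jblock F)) (l a b : F).

(** The monic irreducible polynomial whose roots are the eigenvalues of B. *)
Definition block_factor B : {poly F} :=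
  match B with
  | JReal _ l => 'X - l%:P
  | JComplex _ a b => ('X - a%:P) ^+ 2 + (b ^+ 2)%:P
  end.

Definition block_size B :=
  match B with JReal m _ => m | JComplex m _ _ => m end.

Definition block_poly B := block_factor B ^+ block_size B.

Lemma size_quad (a c : F) : size (('X - a%:P) ^+ 2 + c%:P) = 3.
Proof.
rewrite size_polyDl size_exp_XsubC // (leq_ltn_trans (size_polyC_leq1 _)) //.
Qed.

Lemma size_block_poly B : size (block_poly B) = (jblock_dim B).+1.
Proof.
have nz : block_factor B != 0.
  by case: B => [m l|m a b] /=; rewrite -size_poly_gt0 ?size_XsubC ?size_quad.
rewrite /block_poly -[LHS]prednK ?size_poly_gt0 ?expf_neq0 // size_exp.
case: B {nz} => [m l|m a b] /=; rewrite ?size_XsubC ?size_quad ?mul1n //.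
by rewrite sum_nat_const card_ord mulnC.
Qed.

(** Conditions (a), (b), (c) on the multiset of blocks. *)
Definition balanced (s : seq (jblock F)) : Prop :=
  [/\ forall m (l : F), l != 0 -> mult_real s m l = mult_real s m (- l),
      forall m (a b : F), a != 0 -> b != 0 ->
        mult_complex s m a b = mult_complex s m (- a) b
    & forall m, odd m -> ~~ odd (mult_real s m 0)].

Lemma mult_real_cat s1 s2 m (l : F) :
  mult_real (s1 ++ s2) m l = (mult_real s1 m l + mult_real s2 m l)%N.
Proof. exact: count_cat. Qed.

Lemma mult_complex_cat s1 s2 m (a b : F) :
  mult_complex (s1 ++ s2) m a b =
    (mult_complex s1 m a b + mult_complex s2 m a b)%N.
Proof. exact: count_cat. Qed.

Lemma balanced_cat s1 s2 : balanced s1 -> balanced s2 -> balanced (s1 ++ s2).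
Proof.
move=> [r1 c1 n1] [r2 c2 n2]; split=> [m l l0|m a b a0 b0|m om].
- by rewrite !mult_real_cat (r1 m l l0) (r2 m l l0).
- by rewrite !mult_complex_cat (c1 m a b a0 b0) (c2 m a b a0 b0).
- by rewrite mult_real_cat oddD (negPf (n1 m om)) (negPf (n2 m om)).
Qed.

Lemma balanced_nil : balanced [::].
Proof. by []. Qed.

Lemma balanced_real m l : balanced [:: JReal m l; JReal m (- l)].
Proof.
split=> [k c c0|//|k _]; rewrite /mult_real /= !addn0.
  by rewrite (inj_eq oppr_inj) eqr_oppLR addnC.
by rewrite oppr_eq0 addnn odd_double.
Qed.

Lemma balanced_complex m a b b' : (b' == b) || (b' == - b) ->
  balanced [:: JComplex m a b; JComplex m (- a) b'].
Proof.
move=> bb'; split=> [//|k c d c0 d0|//]; rewrite /mult_complex /= !addn0.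
have -> : (b' == d) || (b' == - d) = (b == d) || (b == - d).
  by case/pred2P: bb' => ->; rewrite // eqr_oppLR (inj_eq oppr_inj) orbC.
by rewrite (inj_eq oppr_inj) eqr_oppLR addnC.
Qed.

Lemma balanced_real0 m : ~~ odd m -> balanced [:: JReal m (0 : F)].
Proof.
move=> em; split=> [k c c0|//|k]; rewrite /mult_real /= !addn0.
  by rewrite [0 == c]eq_sym [0 == - c]eq_sym oppr_eq0 (negPf c0) andbF.
by case: eqP => // <- om; rewrite om in em.
Qed.

Lemma balanced_complex0 m b : balanced [:: JComplex m 0 b].
Proof.
split=> [//|k c d c0 d0|//]; rewrite /mult_complex /= !addn0.
by rewrite [0 == c]eq_sym [0 == - c]eq_sym oppr_eq0 (negPf c0) !andbF.
Qed.

End BlockPolynomials.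

Section Decomposition.
Variables (F : fieldType) (V : vectType F) (f : 'End(V)).
Implicit Types (B : jblock F) (x : jblock F * V) (t : seq (jblock F * V)).

Definition block_span x : {vspace V} := cyc f (jblock_dim x.1) x.2.

(** The cyclic description of a Jordan block: a generator whose annihilator is
    exactly the block polynomial. *)
Definition is_block x : bool :=
  [&& jblock_wf x.1, pact f (block_poly x.1) x.2 == 0
    & \dim (block_span x) == jblock_dim x.1].

(** The dimension equation expresses that the sum of the cyclic spaces is
    direct. *)
Definition decomposes t (U : {vspace V}) : Prop :=
  [/\ all is_block t, (\sum_(x <- t) block_span x)%VS = U
    & \dim U = (\sum_(x <- t) jblock_dim x.1)%N].

Lemma block_span_stable x : is_block x -> stable f (block_span x).
Proof.
by case/and3P=> _ /eqP xu _; apply: cyc_stable xu; rewrite size_block_poly.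
Qed.

Lemma sum_block_span_stable t : all is_block t ->
  stable f (\sum_(x <- t) block_span x)%VS.
Proof.
elim: t => [_|x t IH /= /andP[bx bt]].
  by move=> x; rewrite big_nil !memv0 => /eqP->; rewrite linear0.
by rewrite big_cons; apply: stableD; [apply: block_span_stable|apply: IH].
Qed.

Lemma decomposes_nil : decomposes [::] 0%VS.
Proof. by split; rewrite ?big_nil ?dimv0. Qed.

Lemma decomposes1 x : is_block x -> decomposes [:: x] (block_span x).
Proof.
move=> bx; split; rewrite ?big_seq1 //= ?bx //.
by case/and3P: bx => _ _ /eqP.
Qed.

Lemma decomposes_cat t1 t2 U1 U2 : decomposes t1 U1 -> decomposes t2 U2 ->
  (U1 :&: U2 = 0)%VS -> decomposes (t1 ++ t2) (U1 + U2)%VS.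
Proof.
move=> [b1 s1 d1] [b2 s2 d2] cap0; split; first by rewrite all_cat b1.
  by rewrite big_cat /= s1 s2.
by rewrite dimv_disjoint_sum // big_cat d1 d2.
Qed.

End Decomposition.

Section PolyFacts.
Variable F : fieldType.
Implicit Types p q : {poly F}.

Lemma factor_out p q : (1 < size p)%N -> q != 0 ->
  exists k r, q = p ^+ k * r /\ ~~ (p %| r).
Proof.
move=> sz_p; have [n] := ubnP (size q); elim: n => // n IH in q *.
move=> lt_n q0; have [/dvdpP[q' def_q]|ndvd] := boolP (p %| q); last first.
  by exists 0%N, q; rewrite expr0 mul1r.
have p0 : p != 0 by rewrite -size_poly_gt0 ltnW.
have q'0 : q' != 0 by apply: contraNneq q0 => q'0; rewrite def_q q'0 mul0r.
have [|//|k [r [def_q' ndvd]]] := IH q'.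
  move: lt_n sz_p; rewrite def_q size_mul //.
  by move: (size q') (size p) => i j; lia.
by exists k.+1, r; split=> //; rewrite def_q def_q' exprS mulrC mulrA.
Qed.

End PolyFacts.

Section RealFactor.
Variable R : rcfType.
Implicit Types (p q : {poly R}) (B : jblock R).

Lemma irreducible_quad (a b : R) : b != 0 ->
  irreducible_poly (('X - a%:P) ^+ 2 + (b ^+ 2)%:P).
Proof.
move=> b0; apply: cubic_irreducible => [|x]; first by rewrite size_quad.
rewrite rootE !hornerE; apply/eqP => h.
have := sqr_ge0 (x - a); have : 0 < b ^+ 2 by rewrite exprn_even_gt0.
by move: (_ ^+ 2) (_ ^+ 2) h => c d; lra.
Qed.

Lemma block_factor_irreducible B :
  jblock_wf B -> irreducible_poly (block_factor B).
Proof.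
case: B => [m l|m a b] /=; first by move=> _; apply: irredp_XsubC.
by case/andP=> _ /irreducible_quad.
Qed.

(** A complex root a + ib of q is a root of X - a or of (X - a)^2 + b^2; in the
    second case the remainder of q by this factor is real, of degree at most
    one, and has a root that is not real. *)
Lemma real_factor q : (1 < size q)%N ->
  exists2 B, jblock_wf B & block_factor B %| q.
Proof.
move=> sz_q; pose rc := real_complex R.
have /closed_rootP[[a b] root_q] : size (map_poly rc q) != 1%N.
  by rewrite size_map_poly; case: (size q) sz_q => [|[]].
have [b0|b0] := eqVneq b 0.
  exists (JReal 1 a) => //=; rewrite dvdp_XsubCl.
  by move: root_q; rewrite b0 -[Complex a 0]/(rc a) fmorph_root.
exists (JComplex 1 a b) => //=; set p := _ + _.
have sz_p : size p = 3 by apply: size_quad.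
have p0 : p != 0 by rewrite -size_poly_gt0 sz_p.
have : (size (q %% p)%R < 3)%N by have := ltn_modp q p; rewrite sz_p p0.
have root_p : root (map_poly rc p) (Complex a b).
  rewrite rootE /p rmorphD rmorphXn /= rmorphB /= map_polyX !map_polyC !hornerE.
  by apply/eqP; simpc; congr Complex; ring.
have root_r : root (map_poly rc (q %% p)) (Complex a b).
  move: root_q; rewrite {1}(divp_eq q p) rmorphD rmorphM /= !rootE !hornerE.
  by move: root_p; rewrite rootE => /eqP->; rewrite mulr0 add0r.
move=> sz_r; move: root_r; rewrite rootE (@horner_coef_wide _ 2); last first.
  by rewrite size_map_poly.
rewrite big_ord_recl big_ord1 !coef_map /= expr0 mulr1 expr1.
simpc => /eqP[re im].
have r1 : (q %% p)`_1 = 0.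
  by move/eqP: im; rewrite mulf_eq0 (negPf b0) orbF => /eqP.
have r0 : (q %% p)`_0 = 0 by move: re; rewrite r1 mul0r addr0.
apply/eqP/polyP => [[|[|i]]]; rewrite coef0 // nth_default //.
by rewrite -ltnS (leq_trans sz_r).
Qed.

End RealFactor.

(** * Block bases of cyclic subspaces *)

Section TagnatSums.
Variables (n : nat) (p_ : 'I_n -> nat).

Lemma sum_Rank (M : nmodType) (G : 'I_(\sum_i p_ i) -> M) :
  \sum_k G k = \sum_i \sum_(j < p_ i) G (tagnat.Rank i j).
Proof.
rewrite sig_big_dep (reindex _ tagnat.sig_bij_on) /=.
by apply: eq_bigr => k _; rewrite -[LHS](congr1 G (tagnat.sig2K k)).
Qed.

Lemma mxblock_Rank (T : Type) (B_ : forall i j, 'M[T]_(p_ i, p_ j)) i j k l :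
  mxblock B_ (tagnat.Rank i k) (tagnat.Rank j l) = B_ i j k l.
Proof. by have /matrixP/(_ k l) := mxblockK B_ i j; rewrite mxE. Qed.

End TagnatSums.

Section Conjugation.
Variables (F : fieldType) (V : vectType F) (f : 'End(V)).
Implicit Types (a b : F) (z w : V * V) (E : {vspace V}).

(** Writing a pair z for the complex vector z.1 - i z.2, this is the operator
    f - (a + ib). *)
Definition shift a b z : V * V :=
  (pact f ('X - a%:P) z.1 - b *: z.2, pact f ('X - a%:P) z.2 + b *: z.1).

(** Complex conjugation of z.1 - i z.2. *)
Definition conjz z : V * V := (z.1, - z.2).

Definition mem_pair E z := (z.1 \in E) && (z.2 \in E).

Lemma shiftD a b z w : shift a b (z + w) = shift a b z + shift a b w.
Proof.
rewrite /shift /= !linearD /=; congr pair; rewrite ?scalerDr ?opprD ?scalerN.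
  by rewrite addrACA.
by rewrite addrACA.
Qed.

Lemma iter_shiftD a b k z w :
  iter k (shift a b) (z + w) = iter k (shift a b) z + iter k (shift a b) w.
Proof. by elim: k => //= k ->; rewrite shiftD. Qed.

Lemma conj_shift a b z : conjz (shift a b z) = shift a (- b) (conjz z).
Proof.
rewrite /shift /conjz /=; congr pair; first by rewrite scalerN scaleNr opprK.
by rewrite [pact f _ (- _)]linearN scaleNr opprD.
Qed.

Lemma conj_iter_shift a b k z :
  conjz (iter k (shift a b) z) = iter k (shift a (- b)) (conjz z).
Proof. by elim: k => //= k <-; rewrite conj_shift. Qed.

Lemma shift_norm a b z : shift a (- b) (shift a b z) =
  (pact f (('X - a%:P) ^+ 2 + (b ^+ 2)%:P) z.1,
   pact f (('X - a%:P) ^+ 2 + (b ^+ 2)%:P) z.2).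
Proof.
rewrite /shift /=; move: ('X - a%:P) => P.
rewrite !pactD !expr2 !pactM !pactC; congr pair.
  rewrite [pact f _ (_ - _)]linearB /= [pact f _ (_ *: _)]linearZ /=.
  by rewrite scaleNr opprK scalerDr scalerA addrA subrK.
rewrite [pact f _ (_ + _)]linearD /= [pact f _ (_ *: _)]linearZ /=.
by rewrite scaleNr scalerBr opprB scalerA addrCA addrK addrC.
Qed.

Lemma shift_comm a b d z : shift a b (shift a d z) = shift a d (shift a b z).
Proof.
rewrite /shift /=; move: ('X - a%:P) => P; congr pair.
  rewrite ![pact f _ (_ - _)]linearB /= ![pact f _ (_ *: _)]linearZ /=.
  rewrite !scalerDr !scalerA [d * b]mulrC !opprD !addrA; congr (_ + _).
  by rewrite addrAC.
rewrite ![pact f _ (_ + _)]linearD /= ![pact f _ (_ *: _)]linearZ /=.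
rewrite !scalerBr !scalerA [d * b]mulrC !addrA; congr (_ + _).
by rewrite addrAC.
Qed.

Lemma iter_shift_comm a b d k z :
  shift a b (iter k (shift a d) z) = iter k (shift a d) (shift a b z).
Proof. by elim: k => //= k <-; rewrite shift_comm. Qed.

Lemma iter_shift_norm a b k z : iter k (shift a (- b)) (iter k (shift a b) z) =
  (pact f ((('X - a%:P) ^+ 2 + (b ^+ 2)%:P) ^+ k) z.1,
   pact f ((('X - a%:P) ^+ 2 + (b ^+ 2)%:P) ^+ k) z.2).
Proof.
elim: k => [|k IH]; first by rewrite expr0 !pact1; case: z.
rewrite iterS [iter k.+1 _ z]iterS -iter_shift_comm shift_norm IH.
by rewrite ![_ ^+ k.+1]exprS !pactM.
Qed.

Lemma mem_pair_shift a b E z :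
  stable f E -> mem_pair E z -> mem_pair E (shift a b z).
Proof.
move=> sE /andP[z1 z2].
by rewrite /mem_pair /= memvB ?memvD ?memvZ ?pact_stable.
Qed.

Lemma mem_pair_iter_shift a b E k z :
  stable f E -> mem_pair E z -> mem_pair E (iter k (shift a b) z).
Proof. by move=> sE zE; elim: k => //= k; apply: mem_pair_shift. Qed.

Lemma mem_pair_conj E z : mem_pair E (conjz z) = mem_pair E z.
Proof. by rewrite /mem_pair /= memvN. Qed.

Hypothesis two_neq0 : (2 : F) != 0.

(** X - (a + ib) and X - (a - ib) are coprime.  Concretely, the two shifts of z
    differ by a multiplication by 2ib, and an induction on k + l strips one
    factor at a time. *)
Lemma mem_pair_bezout a b E k l z : b != 0 -> stable f E ->
  mem_pair E (iter k (shift a b) z) ->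
  mem_pair E (iter l (shift a (- b)) z) -> mem_pair E z.
Proof.
move=> b0 sE; have [n] := ubnP (k + l); elim: n => // n IH in k l z *.
case: k => [//|k]; case: l => [//|l] lt_n; rewrite !iterSr => zk zl.
have z1 : mem_pair E (shift a b z).
  apply: (IH k l.+1) => //.
  by rewrite -iter_shift_comm; apply: mem_pair_shift => //; rewrite iterSr.
have z2 : mem_pair E (shift a (- b) z).
  apply: (IH k.+1 l) => //; first by lia.
  by rewrite -iter_shift_comm; apply: mem_pair_shift => //; rewrite iterSr.
case/andP: z1 z2 => /= z11 z12 /andP[/= z21 z22].
have c0 : 2 * b != 0 by rewrite mulf_neq0.
rewrite /mem_pair; apply/andP; split.
  rewrite -[z.1](scalerK c0) memvZ //.
  have -> : (2 * b) *: z.1 = (pact f ('X - a%:P) z.2 + b *: z.1)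
      - (pact f ('X - a%:P) z.2 + (- b) *: z.1).
    rewrite opprD addrACA subrr add0r scaleNr opprK.
    by rewrite -scalerDl -mulr2n mulr_natl.
  exact: memvB.
rewrite -[z.2](scalerK c0) memvZ //.
have -> : (2 * b) *: z.2 = (pact f ('X - a%:P) z.1 - (- b) *: z.2)
    - (pact f ('X - a%:P) z.1 - b *: z.2).
  by rewrite scaleNr opprK opprB addrC addrA subrK -scalerDl -mulr2n mulr_natl.
exact: memvB.
Qed.

End Conjugation.

Lemma sum_superdiagonal (M : nmodType) (m : nat) (j : 'I_m) (G : nat -> M) :
  \sum_(i < m | i.+1 == j :> nat) G i = if (j : nat) is j'.+1 then G j' else 0.
Proof.
case: j => -[|j] lt_j /=; first by rewrite big_pred0.
by rewrite (big_pred1 (Ordinal (ltnW lt_j))) // => i; rewrite /= eqSS.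
Qed.

Section JordanFamilies.
Variables (F : fieldType) (V : vectType F) (f : 'End(V)).
Implicit Types (a b l : F) (u : V) (z : V * V) (B : jblock F).

(** The column convention of [matrix_in_basis], for a single block. *)
Definition jordan_family B (e : 'I_(jblock_dim B) -> V) : Prop :=
  forall j, f (e j) = \sum_i jblock_mx B i j *: e i.

Definition fspan n (e : 'I_n -> V) : {vspace V} := (\sum_i <[e i]>)%VS.

Lemma mem_fspan n (e : 'I_n -> V) i : e i \in fspan e.
Proof. exact/(subvP (sumv_sup i _ (subvv _)))/memv_line. Qed.

Lemma fspan_sub n (e : 'I_n -> V) (U : {vspace V}) :
  (forall i, e i \in U) -> (fspan e <= U)%VS.
Proof. by move=> eU; apply/subv_sumP => i _; rewrite -memvE. Qed.

Lemma jordan_family_stable B (e : 'I_(jblock_dim B) -> V) :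
  jordan_family e -> stable f (fspan e).
Proof.
move=> je; apply/limg_stable; rewrite limg_sum; apply/subv_sumP => j _.
rewrite limg_line -memvE je; apply: memv_suml => i _.
by apply/memvZ/mem_fspan.
Qed.

(** The contribution of the superdiagonal of a Jordan block to column j. *)
Definition previous (M : nmodType) (E : nat -> M) j : M :=
  if j is j'.+1 then E j' else 0.

Lemma jreal_col m l (E : nat -> V) (j : 'I_m) :
  \sum_i jreal_mx m l i j *: E i = l *: E j + previous E j.
Proof.
rewrite (bigD1 j) //= mxE eqxx; congr (_ + _).
rewrite /previous -sum_superdiagonal big_mkcond [RHS]big_mkcond.
apply: eq_bigr => i _ /=.
rewrite mxE; have [->|ne] := eqVneq i j; first by rewrite eq_sym ltn_eqF.
by case: ifP; rewrite ?scale1r ?scale0r.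
Qed.

Definition pick2 z (i : 'I_2) : V := if i == 0 then z.1 else z.2.

Lemma pick2D z w c : pick2 (z + w) c = pick2 z c + pick2 w c.
Proof. by rewrite /pick2; case: ifP. Qed.

Lemma jcomplex_col m a b (e : 'I_(\sum_(i < m) 2) -> V) (Z : nat -> V * V) :
  (forall (i : 'I_m) (c : 'I_2), e (tagnat.Rank i c) = pick2 (Z i) c) ->
  forall (j : 'I_m) (c : 'I_2),
  \sum_k jcomplex_mx m a b k (tagnat.Rank j c) *: e k =
    pick2 ((a *: (Z j).1 + b *: (Z j).2, a *: (Z j).2 - b *: (Z j).1)
           + previous Z j) c.
Proof.
move=> eZ j c; rewrite sum_Rank (bigD1 j) //= pick2D; congr (_ + _).
  under eq_bigr do rewrite eZ mxblock_Rank eqxx mxE.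
  rewrite !big_ord_recl big_ord0 addr0.
  case: c => -[|[|//]] lt_c; rewrite /pick2 //=.
  by rewrite scaleNr addrC.
have -> : pick2 (previous Z j) c = previous (fun i => pick2 (Z i) c) j.
  by case: j => -[|j] ? //=; rewrite /pick2 if_same.
rewrite /previous -sum_superdiagonal big_mkcond [RHS]big_mkcond.
apply: eq_bigr => i _ /=.
have [->|ne] := eqVneq i j; first by rewrite gtn_eqF.
under eq_bigr do rewrite eZ mxblock_Rank (negPf ne).
case: ifP => _; last by apply: big1 => d _; rewrite mxE scale0r.
rewrite (bigD1 c) //= mxE eqxx scale1r big1 ?addr0 // => d dc.
by rewrite mxE (negPf dc) scale0r.
Qed.

Lemma jordan_familyC m a b (e : 'I_(\sum_(i < m) 2) -> V) (Z : nat -> V * V) :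
  (forall (i : 'I_m) (c : 'I_2), e (tagnat.Rank i c) = pick2 (Z i) c) ->
  @jordan_family (JComplex m a b) e <->
  forall j, (j < m)%N -> shift f a b (Z j) = previous Z j.
Proof.
move=> eZ; have shiftE z w : shift f a b z = w <->
    (f z.1, f z.2) = (a *: z.1 + b *: z.2, a *: z.2 - b *: z.1) + w.
  have eqP3 (x p q v : V) : x - p - q = v <-> x = p + q + v.
    split=> [<-|->]; rewrite -[_ - p - q]addrA -opprD addrC.
      by rewrite addNKr.
    by rewrite addKr.
  rewrite /shift !pactB !pactX !pactC; case: z w => [x y] [u v] /=.
  have := eqP3 (f x) (a *: x) (b *: y) u.
  have := eqP3 (f y) (a *: y) (- (b *: x)) v.
  rewrite opprK => yP xP.
  split=> h; have /= e1 := congr1 fst h; have /= e2 := congr1 snd h.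
    by apply: injective_projections; rewrite /=; [apply/xP|apply/yP].
  by congr pair; [apply/xP|apply/yP].
split=> [je j lt_j|rel].
  apply/shiftE; pose i := Ordinal lt_j.
  have col c : f (pick2 (Z j) c) = pick2 ((a *: (Z j).1 + b *: (Z j).2,
      a *: (Z j).2 - b *: (Z j).1) + previous Z j) c.
    by have := je (tagnat.Rank i c); rewrite /= (jcomplex_col a b eZ) eZ.
  by apply: injective_projections; [apply: (col ord0)|apply: (col ord_max)].
move=> k; rewrite /= -(tagnat.sig2K k) (jcomplex_col a b eZ) eZ.
move/shiftE: (rel _ (ltn_ord (tagnat.sig1 k))) => <-.
by rewrite /pick2; case: ifP.
Qed.


Lemma block_family_real m l u : (0 < m)%N -> pact f (('X - l%:P) ^+ m) u = 0 ->
  exists e : 'I_m -> V,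
    @jordan_family (JReal m l) e /\ fspan e = block_span f (JReal m l, u).
Proof.
move=> m_gt0 pu; pose E j := pact f (('X - l%:P) ^+ (m - j.+1)) u.
have je : @jordan_family (JReal m l) (fun i : 'I_m => E i).
  move=> j; rewrite /= jreal_col addrC; apply/eqP; rewrite -subr_eq.
  rewrite -(pactX f) -(pactC f) -pactB -pactM -exprS; case: j => -[|j] lt_j /=.
    by rewrite subn1 prednK // pu.
  by rewrite /E -subSn.
exists (fun i : 'I_m => E i); split=> //.
have sz : size (('X - l%:P) ^+ m) = m.+1 := size_block_poly (JReal m l).
apply/eqP; rewrite eqEsubv; apply/andP; split.
  by apply: fspan_sub => i; apply: mem_cyc pu.
apply: cyc_sub; first exact: jordan_family_stable je.
have lt_m : (m.-1 < m)%N by rewrite prednK.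
have := mem_fspan (fun i : 'I_m => E i) (Ordinal lt_m).
by rewrite /E /= prednK // subnn expr0 pact1.
Qed.

(** The last vector of the family is a generator. *)
Lemma family_block_real m l (e : 'I_m -> V) : (0 < m)%N ->
  @jordan_family (JReal m l) e ->
  exists u, pact f (block_poly (JReal m l)) u = 0 /\
    block_span f (JReal m l, u) = fspan e.
Proof.
case: m e => // m e _ je; pose E k := if insub k is Some i then e i else 0.
have eE i : e i = E i by rewrite /E valK.
have step j : (j < m.+1)%N -> pact f ('X - l%:P) (E j) = previous E j.
  move=> lt_j; have := je (Ordinal lt_j); rewrite /=.
  under eq_bigr do rewrite eE.
  by rewrite jreal_col eE /= pactB pactX pactC => ->; rewrite addrC addKr.
have down k : (k <= m)%N -> pact f (('X - l%:P) ^+ k) (E m) = E (m - k)%N.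
  elim: k => [|k IH] lt_k; first by rewrite expr0 pact1 subn0.
  rewrite exprS pactM IH ?(ltnW lt_k) // step ?ltnS ?leq_subr //.
  by rewrite -[in LHS](subnSK lt_k).
have pu : pact f (('X - l%:P) ^+ m.+1) (E m) = 0.
  by rewrite exprS pactM down // subnn step.
exists (E m); split=> //.
have sz : size (('X - l%:P) ^+ m.+1) = m.+2 := size_block_poly (JReal m.+1 l).
apply/eqP; rewrite eqEsubv; apply/andP; split.
  apply: cyc_sub; first exact: jordan_family_stable je.
  by have := mem_fspan e ord_max; rewrite eE.
apply: fspan_sub => i; rewrite eE.
rewrite -(subKn (ltn_ord i : (i <= m)%N)) -down ?leq_subr //.
exact: mem_cyc pu.
Qed.

Hypothesis two_neq0 : (2 : F) != 0.

Lemma mem_pair_family m (e : 'I_(\sum_(i < m) 2) -> V) (Z : nat -> V * V) j :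
  (forall (i : 'I_m) (c : 'I_2), e (tagnat.Rank i c) = pick2 (Z i) c) ->
  (j < m)%N -> mem_pair (fspan e) (Z j).
Proof.
move=> eZ lt_j; have Zc c := eZ (Ordinal lt_j) c.
have := Zc ord0; have := Zc ord_max; rewrite /pick2 /= /mem_pair => <- <-.
by rewrite !mem_fspan.
Qed.

Lemma fspan_sub_pair m (e : 'I_(\sum_(i < m) 2) -> V) (Z : nat -> V * V) U :
  (forall (i : 'I_m) (c : 'I_2), e (tagnat.Rank i c) = pick2 (Z i) c) ->
  (forall j, (j < m)%N -> mem_pair U (Z j)) -> (fspan e <= U)%VS.
Proof.
move=> eZ ZU; apply: fspan_sub => k; rewrite -(tagnat.sig2K k) eZ /pick2.
by have /andP[z1 z2] := ZU _ (ltn_ord (tagnat.sig1 k)); case: ifP.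
Qed.

(** Start the chain at w0 = (f - (a - ib))^m u and descend with f - (a + ib);
    the m-th step gives p^m u = 0.  The real span E of the real and imaginary parts
    contains u: the vector w0 and its conjugate (f - (a + ib))^m u both have
    real and imaginary parts in E, and [mem_pair_bezout] applies. *)
Lemma block_family_complex m a b u : (0 < m)%N -> b != 0 ->
  pact f (block_poly (JComplex m a b)) u = 0 ->
  exists e : 'I_(\sum_(i < m) 2) -> V,
    @jordan_family (JComplex m a b) e /\
    fspan e = block_span f (JComplex m a b, u).
Proof.
move=> m_gt0 b0 pu.
pose z0 : V * V := (u, 0); pose w0 := iter m (shift f a (- b)) z0.
pose Z j := iter (m - j.+1) (shift f a b) w0.
pose e (k : 'I_(\sum_(i < m) 2)) :=
  pick2 (Z (tagnat.sig1 k)) (inord (tagnat.sig2 k)).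
have eZ (i : 'I_m) (c : 'I_2) : e (tagnat.Rank i c) = pick2 (Z i) c.
  rewrite /e tagnat.Rank1K; congr pick2; apply/val_inj.
  by rewrite tagnat.Rank2K /= inordK.
have je : @jordan_family (JComplex m a b) e.
  apply/(jordan_familyC a b eZ) => j lt_j; rewrite /Z -iterS -subSn // subSS.
  case: j lt_j => [_|j lt_j] /=; last by [].
  rewrite subn0 /w0 -[b in iter m (shift f a b)]opprK iter_shift_norm sqrrN /=.
  by rewrite linear0 pu.
have sW := jordan_family_stable je.
exists e; split=> //; apply/eqP; rewrite eqEsubv; apply/andP; split.
  have sC : stable f (block_span f (JComplex m a b, u)).
    exact: cyc_stable (size_block_poly _) pu.
  apply: (fspan_sub_pair eZ) => j lt_j; do 2 apply: mem_pair_iter_shift => //.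
  have := mem_cyc 1 (size_block_poly _) pu; rewrite pact1 => uW.
  by rewrite /mem_pair uW mem0v.
apply: cyc_sub => //.
have w0W : mem_pair (fspan e) w0.
  have lt_m : (m.-1 < m)%N by rewrite prednK.
  by have := mem_pair_family eZ lt_m; rewrite /Z prednK // subnn.
have : mem_pair (fspan e) z0.
  apply: (mem_pair_bezout two_neq0 b0 sW (a := a) (k := m) (l := m)) => //.
  by rewrite -mem_pair_conj conj_iter_shift /conjz /= oppr0.
by case/andP.
Qed.

(** The real part u of the last vector z of the chain is a generator.  Indeed
    (f - (a + ib))^m z = 0, and (f - (a - ib))^m z equals
    (f - (a - ib))^m (z + conj z), where z + conj z = 2u; so both lie over the
    cyclic space of u, and z as well by [mem_pair_bezout]. *)
Lemma family_block_complex m a b (e : 'I_(\sum_(i < m) 2) -> V) :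
  (0 < m)%N -> b != 0 -> @jordan_family (JComplex m a b) e ->
  exists u, pact f (block_poly (JComplex m a b)) u = 0 /\
    block_span f (JComplex m a b, u) = fspan e.
Proof.
case: m e => // m e _ b0 je.
pose Z k : V * V := if insub k is Some i
  then (e (tagnat.Rank i ord0), e (tagnat.Rank i ord_max)) else 0.
have eZ (i : 'I_m.+1) (c : 'I_2) : e (tagnat.Rank i c) = pick2 (Z i) c.
  rewrite /Z valK /pick2; case: ifP => [/eqP -> //|].
  case: c => -[|[|//]] lt_c //= _.
  by congr (e (tagnat.Rank i _)); apply: val_inj.
have sW := jordan_family_stable je.
have step := (jordan_familyC a b eZ).1 je.
have down k : (k <= m)%N -> iter k (shift f a b) (Z m) = Z (m - k)%N.
  elim: k => [|k IH] lt_k; first by rewrite subn0.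
  rewrite iterS IH ?(ltnW lt_k) // step ?ltnS ?leq_subr //.
  by rewrite -[in LHS](subnSK lt_k).
have last0 : iter m.+1 (shift f a b) (Z m) = 0.
  by rewrite iterS down // subnn step.
set u := (Z m).1.
have pu : pact f (block_poly (JComplex m.+1 a b)) u = 0.
  have /(congr1 fst) := iter_shift_norm f a b m.+1 (Z m).
  rewrite last0 (iter_fix _ (_ : shift f a (- b) 0 = 0)) => [/= <- //|].
  by rewrite /shift /= !linear0 /= addr0.
have sC : stable f (block_span f (JComplex m.+1 a b, u)).
  exact: cyc_stable (size_block_poly _) pu.
have uC : u \in block_span f (JComplex m.+1 a b, u).
  by have := mem_cyc 1 (size_block_poly _) pu; rewrite pact1.
exists u; split=> //; apply/eqP; rewrite eqEsubv; apply/andP; split.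
  by apply: cyc_sub => //; case/andP: (mem_pair_family eZ (ltnSn m)).
have ZmC : mem_pair (block_span f (JComplex m.+1 a b, u)) (Z m).
  apply: (mem_pair_bezout two_neq0 b0 sC (a := a) (k := m.+1) (l := m.+1)).
    by rewrite last0 /mem_pair !mem0v.
  have -> : iter m.+1 (shift f a (- b)) (Z m) =
      iter m.+1 (shift f a (- b)) (Z m + conjz (Z m)).
    have conj0 : iter m.+1 (shift f a (- b)) (conjz (Z m)) = 0.
      by rewrite -(conj_iter_shift f a b m.+1) last0 /conjz oppr0.
    by rewrite iter_shiftD conj0 addr0.
  apply: mem_pair_iter_shift => //; rewrite /mem_pair /= subrr mem0v andbT.
  exact: memvD.
apply: (fspan_sub_pair eZ) => j lt_j.
rewrite -(subKn (lt_j : (j <= m)%N)) -down ?leq_subr //.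
exact: mem_pair_iter_shift.
Qed.

Lemma block_family B u : is_block f (B, u) ->
  exists e : 'I_(jblock_dim B) -> V,
    jordan_family e /\ fspan e = block_span f (B, u).
Proof.
case/and3P=> wfB /eqP pu _; case: B wfB pu => [m l|m a b] /=.
  exact: block_family_real.
by case/andP; apply: block_family_complex.
Qed.

Lemma family_block B (e : 'I_(jblock_dim B) -> V) : jblock_wf B ->
  jordan_family e ->
  exists u, pact f (block_poly B) u = 0 /\ block_span f (B, u) = fspan e.
Proof.
case: B e => [m l|m a b] /= e; first exact: family_block_real.
by case/andP; apply: family_block_complex.
Qed.

End JordanFamilies.

(** * Real Jordan forms as decompositions into cyclic subspaces *)

Section JordanDecomposition.
Variables (F : fieldType) (V : vectType F) (f : 'End(V)).
Hypothesis two_neq0 : (2 : F) != 0.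
Implicit Types (s : seq (jblock F)) (t : seq (jblock F * V)).

Let D s (i : 'I_(size s)) := jblock_dim (tnth (in_tuple s) i).

Lemma jordan_mx_Rank s (i' i : 'I_(size s)) (k : 'I_(D i')) (j : 'I_(D i))
    (v : V) :
  jordan_mx s (tagnat.Rank i' k) (tagnat.Rank i j) *: v =
  if i' == i
  then (conform_mx 0 (jblock_mx (tnth (in_tuple s) i')) : 'M_(D i', D i)) k j
         *: v
  else 0.
Proof.
rewrite /jordan_mx /mxdiag mxblock_Rank.
by case: ifP => // _; rewrite mxE scale0r.
Qed.

Lemma jordan_mx_col s (E : 'I_(\sum_i D i) -> V) (i : 'I_(size s))
    (j : 'I_(D i)) :
  \sum_k jordan_mx s k (tagnat.Rank i j) *: E k =
  \sum_k jblock_mx (tnth (in_tuple s) i) k j *: E (tagnat.Rank i k).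
Proof.
rewrite sum_Rank (bigD1 i) //= [X in _ + X]big1 ?addr0 => [|i' ne].
  by apply: eq_bigr => k _; rewrite jordan_mx_Rank eqxx conform_mx_id.
by apply: big1 => k _; rewrite jordan_mx_Rank (negPf ne).
Qed.

Lemma jordan_form_decomposes s : real_jordan_form f s ->
  exists2 t, map fst t = s & decomposes f t fullv.
Proof.
case=> wf_s [E [basE relE]].
have wfi (i : 'I_(size s)) : jblock_wf (tnth (in_tuple s) i).
  by rewrite (tnth_nth (JReal 0 0)); apply: (all_nthP _ wf_s).
have fam (i : 'I_(size s)) : exists u,
    pact f (block_poly (tnth (in_tuple s) i)) u = 0 /\
    block_span f (tnth (in_tuple s) i, u)
      = fspan (fun j => tnth E (tagnat.Rank i j)).
  apply: family_block => // j; by rewrite relE jordan_mx_col.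
have {fam}[u /all_and2[pu spu]] := fin_all_exists fam.
pose x i := (tnth (in_tuple s) i, u i).
have sum_full : (\sum_i block_span f (x i))%VS = fullv.
  apply/eqP; rewrite eqEsubv subvf -(span_basis basE).
  apply/span_subvP => _ /tnthP[k ->]; rewrite -(tagnat.sig2K k).
  apply: (subvP (sumv_sup (tagnat.sig1 k) isT (subvv _))).
  by rewrite spu; apply: (mem_fspan (fun j => tnth E (tagnat.Rank _ j))).
have dim_full : \dim {:V} = (\sum_(i < size s) D i)%N := size_basis basE.
have dim_le i : (\dim (block_span f (x i)) <= D i)%N by apply: dim_cyc_le.
have dim_eq i : \dim (block_span f (x i)) = D i.
  have le_sum := leqif_sum (fun i (_ : xpredT i) => leqif_eq (dim_le i)).
  have := geq_leqif le_sum; rewrite -dim_full -{1}sum_full dimv_leq_sum.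
  by move=> /esym/forallP/(_ i)/eqP.
exists [seq x i | i <- enum 'I_(size s)].
  by rewrite -map_comp -[RHS](map_tnth_enum (in_tuple s)).
split; rewrite ?big_map ?big_enum //.
rewrite all_map; apply/allP => i _.
by rewrite /is_block /= pu dim_eq !eqxx wfi.
Qed.

Lemma decomposes_jordan_form t : decomposes f t fullv ->
  real_jordan_form f (map fst t).
Proof.
case=> bt sum_t dim_t; split.
  by rewrite all_map; apply: sub_all bt => x /and3P[].
set s := map fst t; pose x0 : jblock F * V := (JReal 0 0, 0).
pose x (i : 'I_(size s)) := (tnth (in_tuple s) i, (nth x0 t i).2).
have lt_t (i : 'I_(size s)) : (i < size t)%N by rewrite -(size_map fst) ltn_ord.
have xE i : x i = nth x0 t i.
  rewrite /x (tnth_nth x0.1) (nth_map x0) ?lt_t //; by case: (nth x0 t i).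
have sum_x : (\sum_i block_span f (x i))%VS = fullv.
  rewrite -sum_t (big_nth x0) -(size_map fst t) big_mkord.
  by apply: eq_bigr => i _; rewrite xE.
have dim_x : \dim {:V} = (\sum_(i < size s) D i)%N.
  rewrite dim_t (big_nth x0) -(size_map fst t) big_mkord.
  by apply: eq_bigr => i _; rewrite -xE.
have fam i :
    exists e : 'I_(D i) -> V, jordan_family f e /\ fspan e = block_span f (x i).
  apply: (@block_family _ _ f two_neq0 (x i).1 (x i).2).
  by rewrite -[(_, _)]/(x i) xE; apply: (all_nthP _ bt).
have {fam}[e /all_and2[je spe]] := fin_all_exists fam.
pose E k := e (tag (tagnat.sig k)) (tagged (tagnat.sig k)).
have ER i j : E (tagnat.Rank i j) = e i j by rewrite /E tagnat.rankK.
exists [tuple E k | k < \sum_i D i]; split.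
  rewrite basisEdim [X in (_ <= X)%N]dim_x size_tuple leqnn andbT -sum_x.
  apply/subv_sumP => i _; rewrite -spe; apply: fspan_sub => j.
  rewrite -ER; apply/memv_span/mapP.
  by exists (tagnat.Rank i j); rewrite ?mem_enum.
have tE k : tnth [tuple E k | k < \sum_i D i] k = E k by rewrite tnth_mktuple.
move=> k; rewrite -(tagnat.sig2K k) tE ER je.
under [RHS]eq_bigr do rewrite tE.
by rewrite jordan_mx_col; apply: eq_bigr => j _; rewrite ER.
Qed.

End JordanDecomposition.

(** * From an invariant symplectic form to balanced blocks *)

Section FactorReflection.
Variable R : rcfType.
Implicit Types (a b l : R).

Lemma prefl_linear m l :
  prefl (block_factor (JReal m l)) = - block_factor (JReal m (- l)).
Proof. by rewrite /= linearB /= preflX preflC polyCN opprK opprD. Qed.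

Lemma prefl_quad m a b :
  prefl (block_factor (JComplex m a b)) = block_factor (JComplex m (- a) b).
Proof.
rewrite /= linearD rmorphXn /= linearB /= preflX !preflC polyCN.
by rewrite -opprD sqrrN opprK.
Qed.

Lemma coprime_linear m l : l != 0 ->
  coprimep (block_factor (JReal m l)) (prefl (block_factor (JReal m l))).
Proof.
move=> l0; rewrite irreducible_poly_coprime; last exact: irredp_XsubC.
rewrite prefl_linear dvdpNr /= dvdp_XsubCl rootE !hornerE.
by rewrite opprK -mulr2n mulrn_eq0.
Qed.

Lemma coprime_quad m a b : a != 0 -> b != 0 ->
  coprimep (block_factor (JComplex m a b))
           (prefl (block_factor (JComplex m a b))).
Proof.
move=> a0 b0; rewrite irreducible_poly_coprime; last exact: irreducible_quad.
apply/negP=> dvd.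
have diff :
  prefl (block_factor (JComplex m a b)) - block_factor (JComplex m a b)
    = (4 * a) *: 'X.
  by rewrite prefl_quad /= polyCN -mul_polyC polyCM; ring.
have : block_factor (JComplex m a b) %| (4 * a) *: 'X.
  by rewrite -diff dvdp_subr.
have c0 : 4 * a != 0 by rewrite mulf_neq0 ?pnatr_eq0.
rewrite dvdpZr // => /dvdp_leq; rewrite polyX_eq0 size_polyX size_quad.
by move=> /(_ isT).
Qed.

End FactorReflection.

Section Splitting.
Variables (R : rcfType) (V : vectType R) (f : 'End(V)).
Variable sg : {skew_symmetric V}.
Hypothesis sp : in_sp sg f.
Implicit Types (u v x y : V) (U W Z : {vspace V}) (B : jblock R).

Let two_neq0 : (2 : R) != 0. Proof. by rewrite pnatr_eq0. Qed.

(** Strip the irreducible factors of q one at a time until the vector dies. *)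
Lemma eigen_factor U q x : stable f U -> x \in U -> x != 0 -> q != 0 ->
  pact f q x = 0 ->
  exists B y, [/\ jblock_wf B, y \in U, y != 0 & pact f (block_factor B) y = 0].
Proof.
move=> sU; have [n] := ubnP (size q); elim: n => // n IH in q x *.
move=> lt_n xU x0 q0 qx; have [sz_q|sz_q] := leqP (size q) 1.
  have [c def_q] : exists c, q = c%:P by exists q`_0; apply: size1_polyC.
  move: qx x0; rewrite def_q pactC => /eqP; rewrite scaler_eq0.
  by move: q0; rewrite def_q polyC_eq0 => /negPf -> /= ->.
have [B wfB /dvdpP[r def_q]] := real_factor sz_q.
have [rx|rx] := eqVneq (pact f r x) 0; last first.
  exists B, (pact f r x); split=> //; first exact: pact_stable.
  by rewrite -pactM mulrC -def_q.
have r0 : r != 0 by apply: contraNneq q0 => r0; rewrite def_q r0 mul0r.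
apply: (IH r x) => //.
have irr := block_factor_irreducible wfB; have [sz_p _] := irr.
move: lt_n sz_p; rewrite def_q size_mul ?(irredp_neq0 irr) //.
by move: (size r) (size (block_factor B)) => i j; lia.
Qed.

(** If p has a nonzero kernel in U, then r with p^k r = 0 on U and r prime to p
    does not kill U; the least exponent of p that suffices is m + 1 for some m,
    and [dual_generators] applies. *)
Lemma primary_generators U : stable f U -> nondeg sg U -> U != 0%VS ->
  exists B m u v, jblock_wf B /\ [/\ u \in U, v \in U,
    pact f (block_factor B ^+ m.+1) u = 0,
    pact f (prefl (block_factor B) ^+ m.+1) v = 0
    & sg (pact f (block_factor B ^+ m) u) v != 0].
Proof.
move=> sU nU; rewrite -vpick0 => x0.
have [q q0 ann] := annihilator f.
have [B [y [wfB yU y0 py]]] := eigen_factor sU (memv_pick U) x0 q0 (ann _).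
have irr := block_factor_irreducible wfB; set p := block_factor B in irr py.
have [k [r [def_q ndvd]]] := factor_out irr.1 q0.
have ry : pact f r y != 0.
  move: ndvd; rewrite -irreducible_poly_coprime // => /Bezout_eq1_coprimepP.
  case=> -[a b] /= ab1; apply: contraNneq y0 => ry.
  by rewrite -(pact1 f y) -ab1 pactD !pactM py ry !linear0 addr0.
have {ann}: {in U, forall x, pact f (p ^+ k * r) x = 0}.
  by move=> x _; rewrite -def_q.
elim: k {def_q} => [|m IH] ann.
  by move: ry; rewrite -[r]mul1r -(expr0 p) ann ?eqxx.
have [sub|/subvPn[z zU nz]] :=
    boolP (U <= lker (linfun (pact f (p ^+ m * r))))%VS.
  apply: IH => x /(subvP sub); rewrite memv_ker lfunE; by move/eqP.
rewrite memv_ker lfunE /= in nz.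
have [u [v [uU vU pu pv uv]]] := dual_generators sp irr ndvd sU nU ann zU nz.
by exists B, m, u, v.
Qed.

Lemma is_block_irr B m u : jblock_wf B -> block_size B = m.+1 ->
  pact f (block_poly B) u = 0 -> pact f (block_factor B ^+ m) u != 0 ->
  is_block f (B, u).
Proof.
move=> wfB sz pu nz; apply/and3P; split=> //; first by rewrite pu.
rewrite /block_poly sz in pu.
have := dim_cyc_irr (block_factor_irreducible wfB) pu nz.
by rewrite -sz -/(block_poly B) size_block_poly => /eqP.
Qed.

Lemma nondeg_coprime_blocks B B' m u v : jblock_wf B -> jblock_wf B' ->
  block_size B = m.+1 -> block_size B' = m.+1 ->
  prefl (block_factor B) %= block_factor B' ->
  coprimep (block_factor B) (prefl (block_factor B)) ->
  pact f (block_poly B) u = 0 -> pact f (prefl (block_poly B)) v = 0 ->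
  sg (pact f (block_factor B ^+ m) u) v != 0 ->
  exists W, decomposes f [:: (B, u); (B', v)] W /\ nondeg sg W.
Proof.
move=> wfB wfB' sz sz' pp' cop pu pv nz.
have irr := block_factor_irreducible wfB.
have pv' : pact f (block_poly B') v = 0.
  apply: pact_dvd pv; rewrite /block_poly sz sz' rmorphXn /=.
  by case/andP: (eqp_exp m.+1 pp').
have bu : is_block f (B, u).
  apply: (is_block_irr _ sz pu) => //.
  by apply: contraNneq nz => ->; rewrite linear0l.
have bv : is_block f (B', v).
  apply: (is_block_irr _ sz' pv') => //; apply: contraNneq nz => p'v.
  rewrite form_pact // rmorphXn /= (pact_dvd _ p'v) ?linear0r //.
  by case/andP: (eqp_exp m pp').
have dimE : jblock_dim B' = jblock_dim B.
  apply: succn_inj; rewrite -!size_block_poly -(size_prefl (block_poly B)).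
  by apply/esym/eqp_size; rewrite /block_poly sz sz' rmorphXn eqp_exp.
rewrite /block_poly sz in pu; rewrite /block_poly sz rmorphXn /= in pv.
have [] := nondeg_cyc_pair sp irr cop pu pv nz.
rewrite -{1 2 3 4}sz -/(block_poly B) size_block_poly /= => cap0 nW.
exists (block_span f (B, u) + block_span f (B', v))%VS.
rewrite /block_span /= dimE; split=> //.
rewrite -{2}dimE -cat1s; apply: decomposes_cat; try exact: decomposes1.
by rewrite /block_span /= dimE.
Qed.

Lemma nondeg_selfdual_block B m q u : jblock_wf B -> block_size B = m.+1 ->
  pact f (block_poly B) u = 0 ->
  sg (pact f (block_factor B ^+ m * q) u) u != 0 ->
  exists W, decomposes f [:: (B, u)] W /\ nondeg sg W.
Proof.
move=> wfB sz pu nz; have irr := block_factor_irreducible wfB.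
exists (block_span f (B, u)); split.
  apply/decomposes1/(is_block_irr wfB sz pu); apply: contraNneq nz => pmu.
  by rewrite mulrC pactM pmu !linear0 linear0l.
rewrite /block_span /= -[jblock_dim B]/(jblock_dim B).+1.-1 -size_block_poly.
rewrite /block_poly sz in pu *.
by apply: (nondeg_cyc sp irr pu (q := q)); rewrite -pactM.
Qed.

Lemma decomposes_bounds (x : jblock R * V) t U W : stable f U ->
  all (fun y : jblock R * V => y.2 \in U) (x :: t) ->
  decomposes f (x :: t) W -> (W <= U)%VS /\ W != 0%VS.
Proof.
move=> sU memU [bt <- dimW]; split.
  elim: (x :: t) memU {bt dimW} => [|y s IH] /=; first by rewrite big_nil sub0v.
  by case/andP=> yU sU'; rewrite big_cons subv_add IH // cyc_sub.
rewrite -dimv_eq0 dimW big_cons addn_eq0 negb_and.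
case/andP: bt => /and3P[wfx _ _] _; apply/orP; left.
case: x.1 wfx => [k l|k a b] /=; first by rewrite lt0n.
by case/andP=> k0 _; rewrite sum_nat_const card_ord muln_eq0 orbF -lt0n.
Qed.

Lemma symm_generator U B m g u v : prefl g = - g -> u \in U -> v \in U ->
  pact f (block_factor B ^+ m) u = 0 -> pact f (block_factor B ^+ m) v = 0 ->
  sg (pact f g u) v != 0 ->
  exists w,
    [/\ w \in U, pact f (block_factor B ^+ m) w = 0 & sg (pact f g w) w != 0].
Proof.
move=> gN uU vU pu pv nz.
pose K := (U :&: lker (linfun (pact f (block_factor B ^+ m))))%VS.
have inK x : (x \in K) = (x \in U) && (pact f (block_factor B ^+ m) x == 0).
  by rewrite memv_cap memv_ker lfunE.
have [] := symm_nonisotropic sp two_neq0 (U := K) gN _ _ nz.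
- by rewrite inK uU pu /=.
- by rewrite inK vU pv /=.
by move=> w; rewrite inK => /andP[wU /eqP pw] ww; exists w.
Qed.

(** The case distinction of (iii).  Pairs of distinct blocks come from prime
    factors that are coprime to their reflection, single blocks from a g with
    g(-X) = -g, and pairs of equal blocks from the remaining nilpotent case. *)
Lemma nondeg_summand U : stable f U -> nondeg sg U -> U != 0%VS ->
  exists t W, [/\ decomposes f t W, balanced (map fst t), (W <= U)%VS,
    nondeg sg W & W != 0%VS].
Proof.
move=> sU nU U0.
suff [x [t [W [dW bW memU nW]]]] : exists (x : jblock R * V) t W,
    [/\ decomposes f (x :: t) W, balanced (map fst (x :: t)),
        all (fun y : jblock R * V => y.2 \in U) (x :: t) & nondeg sg W].
  by have [WU W0] := decomposes_bounds sU memU dW; exists (x :: t), W.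
have [B [m [u [v [wfB [uU vU pu pv nz]]]]]] := primary_generators sU nU U0.
case: B wfB pu pv nz => [k l _|k a b /= /andP[_ b0]].
  have [->|l0] := eqVneq l 0.
    have X0 : block_factor (JReal k (0 : R)) = 'X by rewrite /= polyC0 subr0.
    have X0' : block_factor (JReal m.+1 (0 : R)) = 'X.
      by rewrite /= polyC0 subr0.
    rewrite !X0 preflX => pu pv nz.
    have {}pv : pact f 'X^(m.+1) v = 0.
      apply: pact_dvd pv; rewrite exprNn -signr_odd mulr_sign.
      by case: ifP; rewrite ?dvdpNl dvdpp.
    have [m_odd|m_even] := boolP (odd m).
      have gN : prefl ('X^m) = - 'X^m :> {poly R}.
        by rewrite rmorphXn /= preflX exprNn -signr_odd m_odd mulN1r.
      have [|||w [wU pw ww]] :=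
        @symm_generator U (JReal k 0) m.+1 _ u v gN uU vU; rewrite ?X0 //.
      rewrite X0 in pw.
      have [||W [dW nW]] :=
        @nondeg_selfdual_block (JReal m.+1 0) m 1 w isT (erefl _).
      + by rewrite /block_poly X0'.
      + by rewrite X0' mulr1.
      exists (JReal m.+1 0, w), [::], W; rewrite /= wU; split=> //.
      by apply: balanced_real0; rewrite /= m_odd.
    have [cap0 nW] := nondeg_nil_pair sp two_neq0 m_even pu pv nz.
    have blk w : pact f 'X^(m.+1) w = 0 -> pact f 'X^m w != 0 ->
        is_block f (JReal m.+1 0, w).
      move=> pw pmw; apply: (@is_block_irr _ m) => //.
        by rewrite /block_poly X0'.
      by rewrite X0'.
    exists (JReal m.+1 0, u), [:: (JReal m.+1 0, v)].
    exists (cyc f m.+1 u + cyc f m.+1 v)%VS; rewrite /= uU vU; split=> //.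
      apply: (@decomposes_cat _ _ _ [:: _] [:: _]) => //; apply: decomposes1.
        by apply: blk => //; apply: contraNneq nz => ->; rewrite linear0l.
      apply: blk => //; apply: contraNneq nz => pmv.
      rewrite form_pact // rmorphXn /= preflX exprNn pactM pmv.
      by rewrite !linear0.
    by have := @balanced_real R m.+1 0; rewrite oppr0.
  move=> pu pv nz.
  have [|||||||||W [dW nW]] :=
    @nondeg_coprime_blocks (JReal m.+1 l) (JReal m.+1 (- l)) m u v; rewrite //.
  - by rewrite (prefl_linear m.+1) -scaleN1r eqp_scale ?oppr_eq0 ?oner_neq0.
  - exact: (coprime_linear m.+1).
  - by rewrite /block_poly rmorphXn.
  exists (JReal m.+1 l, u), [:: (JReal m.+1 (- l), v)], W; rewrite /= uU vU.
  by split=> //; apply: balanced_real.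
have [->|a0] := eqVneq a 0.
  set p := _ + _ => pu pv nz.
  have pE : prefl p = p.
    by have := prefl_quad k 0 b; rewrite oppr0.
  rewrite pE in pv.
  (* p is even, hence p^m X is odd for every m. *)
  have gN : prefl (p ^+ m * 'X) = - (p ^+ m * 'X).
    by rewrite rmorphM rmorphXn /= pE preflX mulrN.
  (* (u, f v) is a pair with a nonzero value: X^2 acts on p^m u as - b^2. *)
  have [||||w [wU pw ww]] :=
    @symm_generator U (JComplex k 0 b) m.+1 _ u (f v) gN uU; rewrite //.
  - exact: sU.
  - by rewrite -pactX pact_comm pv linear0.
  - rewrite -[f v](pactX f) form_adj // preflX pactN linearNl /= oppr_eq0.
    rewrite mulrC -!pactM mulrA.
    have -> : 'X * 'X = p - (b ^+ 2)%:P by rewrite /p polyC0 subr0 addrK expr2.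
    rewrite mulrBl pactB -exprS pu sub0r mul_polyC pactZ.
    rewrite linearNl linearZl_LR /=.
    by rewrite oppr_eq0 mulf_neq0 // expf_neq0.
  have [||||W [dW nW]] :=
    @nondeg_selfdual_block (JComplex m.+1 0 b) m 'X w; rewrite //=.
  exists (JComplex m.+1 0 b, w), [::], W; rewrite /= wU; split=> //.
  exact: balanced_complex0.
move=> pu pv nz.
have [|||||||||W [dW nW]] :=
  @nondeg_coprime_blocks (JComplex m.+1 a b) (JComplex m.+1 (- a) b) m u v;
  rewrite //.
- by rewrite (prefl_quad m.+1) eqpxx.
- exact: (coprime_quad m.+1).
- by rewrite /block_poly rmorphXn.
exists (JComplex m.+1 a b, u), [:: (JComplex m.+1 (- a) b, v)], W.
rewrite /= uU vU; split=> //.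
by apply: balanced_complex; rewrite eqxx.
Qed.

Lemma nondeg_decomposition U : stable f U -> nondeg sg U ->
  exists2 t, decomposes f t U & balanced (map fst t).
Proof.
have [n] := ubnP (\dim U); elim: n U => // n IH U lt_n sU nU.
have [->|U0] := eqVneq U 0%VS.
  by exists [::]; [apply: decomposes_nil|apply: balanced_nil].
have [t [W [dW bW WU nW W0]]] := nondeg_summand sU nU U0.
have [cap0 sumU nW'] := nondeg_split WU nU nW.
have sW : stable f W.
  by have [bt <- _] := dW; apply: sum_block_span_stable.
have [|||t' dt' bt'] := IH (U :&: orthov sg W)%VS.
- move: lt_n; rewrite -{1}sumU dimv_disjoint_sum //.
  by move: W0; rewrite -dimv_eq0; lia.
- by apply: stableI => //; apply: orthov_stable.
- exact: nW'.
exists (t ++ t'); last by rewrite map_cat; apply: balanced_cat.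
by rewrite -{1}sumU; apply: decomposes_cat.
Qed.

End Splitting.

(** * Invariant forms on cyclic subspaces *)

Section CyclicForms.
Variables (F : fieldType) (V : vectType F) (f : 'End(V)).
Implicit Types (x y u v : V) (U W : {vspace V}) (p q g h P Q : {poly F}).

(** The polynomial g of degree less than n with x = g u, when x lies in the
    cyclic space. *)
Definition cycpoly n u x : {poly F} :=
  \sum_(i < n) coord [tuple of mkseq (fun i => iter i f u) n] i x *: 'X^i.

Fact cycpoly_is_linear n u : linear (cycpoly n u).
Proof.
move=> a x y; rewrite /cycpoly scaler_sumr -big_split; apply: eq_bigr => i _ /=.
by rewrite linearP scalerDl scalerA.
Qed.
HB.instance Definition _ n u := GRing.isLinear.Build F V {poly F} *:%R
  (cycpoly n u) (cycpoly_is_linear n u).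

Lemma size_cycpoly n u x : (size (cycpoly n u x) <= n)%N.
Proof.
apply: (leq_trans (size_sum _ _ _)); apply/bigmax_leqP => i _.
by rewrite (leq_trans (size_scale_leq _ _)) // size_polyXn.
Qed.

Lemma cycpolyK n u x : x \in cyc f n u -> pact f (cycpoly n u x) u = x.
Proof.
set X := [tuple of mkseq (fun i => iter i f u) n].
rewrite {1}/cyc -/(tval X) => xX; rewrite [RHS](coord_span xX) /cycpoly -/X.
have sumE (I : finType) (c : I -> F) (e : I -> nat) :
    pact f (\sum_i c i *: 'X^(e i)) u = \sum_i c i *: iter (e i) f u.
  elim/big_rec2: _ => [|i z q _ <-]; first by rewrite pact0.
  by rewrite pactD pactZ pactXn.
by rewrite sumE; apply: eq_bigr => i _; rewrite nth_mkseq.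
Qed.

Lemma cycpoly_pact n u P g : size P = n.+1 -> pact f P u = 0 ->
  \dim (cyc f n u) = n -> P %| g - cycpoly n u (pact f g u).
Proof.
move=> szP Pu dim_c; apply: (cyc_full_dvd szP Pu dim_c).
by rewrite pactB cycpolyK ?subrr //; apply: mem_cyc Pu.
Qed.

(** For P of degree n and g a polynomial, this is up to a scalar the residue at
    infinity of g / P. *)
Definition residue n P g : F := (g %% P)`_n.-1.

Lemma residueD n P g h : residue n P (g + h) = residue n P g + residue n P h.
Proof. by rewrite /residue modpD coefD. Qed.

Lemma residueZ n P a g : residue n P (a *: g) = a * residue n P g.
Proof. by rewrite /residue modpZl coefZ. Qed.

Lemma residue_eq n P g h : P %| g - h -> residue n P g = residue n P h.
Proof.
move=> dvd; rewrite -[g in LHS](subrK h) residueD /residue.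
by move: dvd; rewrite /dvdp => /eqP ->; rewrite coef0 add0r.
Qed.

Lemma residue_top n P g : size P = n.+1 -> size g = n -> g != 0 ->
  residue n P g != 0.
Proof.
move=> szP szg g0; rewrite /residue modp_small ?szP ?szg //.
by rewrite -szg -lead_coefE lead_coef_eq0.
Qed.

(** Reflection commutes with the remainder modulo a self-dual P, and n - 1 is
    odd. *)
Lemma residue_prefl n P g : prefl P %= P -> (0 < n)%N -> ~~ odd n ->
  size P = n.+1 -> residue n P (prefl g) = - residue n P g.
Proof.
move=> selfP n_gt0 n_even szP; have P0 : P != 0 by rewrite -size_poly_eq0 szP.
rewrite /residue {1}(divp_eq g P) linearD rmorphM /= modpD.
have -> : (prefl (g %/ P) * prefl P) %% P = 0.
  by apply/eqP; rewrite -/(dvdp _ _) dvdp_mull //; case/andP: selfP.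
rewrite add0r modp_small ?size_prefl ?ltn_modp // coef_prefl.
by rewrite -signr_odd -subn1 oddB // (negPf n_even) expr1 mulN1r.
Qed.

Definition cycpair n P u v x y : F :=
  residue n P (cycpoly n u x * prefl (cycpoly n v y)).

Lemma cycpair_linearl n P u v a x1 x2 y :
  cycpair n P u v (a *: x1 + x2) y =
    a * cycpair n P u v x1 y + cycpair n P u v x2 y.
Proof. by rewrite /cycpair linearP mulrDl -scalerAl residueD residueZ. Qed.

Lemma cycpair_linearr n P u v a x y1 y2 :
  cycpair n P u v x (a *: y1 + y2) =
    a * cycpair n P u v x y1 + cycpair n P u v x y2.
Proof.
by rewrite /cycpair linearP linearP mulrDr -scalerAr residueD residueZ.
Qed.

Section Pair.
Variables (n : nat) (P Q : {poly F}) (u v : V).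
Hypotheses (szP : size P = n.+1) (PQ : prefl P %= Q).
Hypotheses (Pu : pact f P u = 0) (Qv : pact f Q v = 0).
Hypotheses (dim_u : \dim (cyc f n u) = n) (dim_v : \dim (cyc f n v) = n).
Let szQ : size Q = n.+1. Proof. by rewrite -(eqp_size PQ) size_prefl. Qed.

Lemma cycpairE g h :
  cycpair n P u v (pact f g u) (pact f h v) = residue n P (g * prefl h).
Proof.
have dvd_g := cycpoly_pact g szP Pu dim_u.
have dvd_h := cycpoly_pact h szQ Qv dim_v.
set g' := cycpoly n u _ in dvd_g *; set h' := cycpoly n v _ in dvd_h *.
rewrite /cycpair -/g' -/h'; apply/esym/residue_eq.
have -> : g * prefl h - g' * prefl h' =
    (g - g') * prefl h + g' * prefl (h - h') by rewrite linearB /=; ring.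
apply: dvdp_add; first exact: dvdp_mulr.
by rewrite dvdp_mull // -[P]preflK prefl_dvd (eqp_dvdl _ PQ).
Qed.

Lemma cycpair_invariant x y : x \in cyc f n u -> y \in cyc f n v ->
  cycpair n P u v (f x) y + cycpair n P u v x (f y) = 0.
Proof.
move=> /cycP[g _ ->] /cycP[h _ ->]; rewrite -!(pactX f) -!pactM !cycpairE.
rewrite -residueD rmorphM /= preflX.
rewrite [X in residue _ _ X](_ : _ = 0); last by ring.
by rewrite /residue mod0p coef0.
Qed.

(** Multiplying g by the power of X that brings its degree to n - 1 produces a
    nonzero residue. *)
Lemma cycpair_nondegl x : x \in cyc f n u ->
  {in cyc f n v, forall y, cycpair n P u v x y = 0} -> x = 0.
Proof.
move=> xu xo; rewrite -(cycpolyK xu); set g := cycpoly n u x.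
have [->|g0] := eqVneq g 0; first by rewrite pact0.
pose k := (n - size g)%N.
have := xo _ (mem_cyc 'X^k szQ Qv); rewrite -(cycpolyK xu) -/g cycpairE.
rewrite rmorphXn /= preflX exprNn -signr_odd mulrCA mulr_sign.
have sz_gX : size (g * 'X^k) = n.
  by rewrite size_mulXn // subnK // size_cycpoly.
have := residue_top szP sz_gX.
rewrite mulf_neq0 ?expf_neq0 ?polyX_eq0 // => /(_ isT).
case: ifP => _ nz /eqP; last by rewrite (negPf nz).
by rewrite -scaleN1r residueZ mulN1r oppr_eq0 (negPf nz).
Qed.

Lemma cycpair_nondegr y : y \in cyc f n v ->
  {in cyc f n u, forall x, cycpair n P u v x y = 0} -> y = 0.
Proof.
move=> yv yo; rewrite -(cycpolyK yv); set h := cycpoly n v y.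
have [->|h0] := eqVneq h 0; first by rewrite pact0.
pose k := (n - size h)%N.
have := yo _ (mem_cyc 'X^k szP Pu); rewrite -(cycpolyK yv) -/h cycpairE => /eqP.
have h'0 : prefl h != 0 by rewrite -size_poly_eq0 size_prefl size_poly_eq0.
rewrite mulrC (negPf (residue_top szP _ _)) ?mulf_neq0 ?expf_neq0 ?polyX_eq0 //.
by rewrite size_mulXn // size_prefl subnK // size_cycpoly.
Qed.

End Pair.

(** Bilinear and skew on the whole space, but invariant and nondegenerate on U
    only: this makes sums over complementary subspaces easy to form. *)
Definition invariant_form (s : V -> V -> F) U : Prop :=
  [/\ forall a x1 x2 y, s (a *: x1 + x2) y = a * s x1 y + s x2 y,
      forall x y, s x y = - s y x,
      {in U &, forall x y, s (f x) y + s x (f y) = 0}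
    & {in U, forall x, {in U, forall y, s x y = 0} -> x = 0}].

Definition has_invariant_form U := exists s, invariant_form s U.

Lemma form_zero : has_invariant_form 0%VS.
Proof.
exists (fun _ _ => 0); split=> [a x1 x2 y|x y|x y _ _|x].
- by rewrite mulr0 addr0.
- by rewrite oppr0.
- by rewrite addr0.
by rewrite memv0 => /eqP.
Qed.

Lemma cap0_sym U W : (U :&: W = 0 -> W :&: U = 0)%VS.
Proof. by rewrite capvC. Qed.

Lemma pi_other U W w : (U :&: W = 0)%VS -> w \in W -> daddv_pi U W w = 0.
Proof.
move=> cap0 wW; have := daddv_pi_add cap0 (subvP (addvSr U W) _ wW).
rewrite (daddv_pi_id (cap0_sym cap0) wW) => /(canRL (addrK _)).
by rewrite subrr.
Qed.

Lemma pi_stable U W x : (U :&: W = 0)%VS -> stable f U -> stable f W ->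
  x \in (U + W)%VS -> daddv_pi U W (f x) = f (daddv_pi U W x).
Proof.
move=> cap0 sU sW /memv_addP[y yU [z zW ->]].
rewrite !linearD /= (daddv_pi_id cap0 yU) (daddv_pi_id cap0 (sU _ yU)).
by rewrite (pi_other cap0 zW) (pi_other cap0 (sW _ zW)) linear0.
Qed.

Lemma form_sum U W : (U :&: W = 0)%VS -> stable f U -> stable f W ->
  has_invariant_form U -> has_invariant_form W -> has_invariant_form (U + W)%VS.
Proof.
move=> cap0 sU sW [s1 [lin1 sk1 inv1 nd1]] [s2 [lin2 sk2 inv2 nd2]].
have cap0' := cap0_sym cap0.
pose p1 := daddv_pi U W; pose p2 := daddv_pi W U.
exists (fun x y => s1 (p1 x) (p1 y) + s2 (p2 x) (p2 y)); split.
- by move=> a x1 x2 y; rewrite !linearP lin1 lin2 mulrDr addrACA.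
- by move=> x y; rewrite sk1 sk2 opprD.
- move=> x y xUW yUW; rewrite /p1 /p2 !pi_stable // 1?addvC //.
  by rewrite addrACA inv1 ?inv2 ?memv_pi // addr0.
have lin0 (s : V -> V -> F) x :
    (forall a x1 x2 y, s (a *: x1 + x2) y = a * s x1 y + s x2 y) -> s 0 x = 0.
  by move=> lin; have := lin (-1) 0 0 x; rewrite scaler0 addr0 mulN1r addNr.
have lin0r (s : V -> V -> F) x : (forall x y, s x y = - s y x) ->
    (forall a x1 x2 y, s (a *: x1 + x2) y = a * s x1 y + s x2 y) -> s x 0 = 0.
  by move=> sk lin; rewrite sk lin0 ?oppr0.
move=> _ /memv_addP[y yU [z zW ->]] xo.
have y0 : y = 0.
  apply: nd1 => // w wU; have := xo w (subvP (addvSl _ _) _ wU).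
  rewrite /p1 /p2 !linearD /= (daddv_pi_id cap0 yU) (daddv_pi_id cap0 wU).
  by rewrite (pi_other cap0 zW) (pi_other cap0' wU) addr0 (lin0r s2) // addr0.
have z0 : z = 0.
  apply: nd2 => // w wW; have := xo w (subvP (addvSr _ _) _ wW).
  rewrite /p1 /p2 !linearD /= (daddv_pi_id cap0' zW) (daddv_pi_id cap0' wW).
  rewrite (pi_other cap0' yU).
  by rewrite (pi_other cap0 wW) add0r (lin0r s1) // add0r.
by rewrite y0 z0 addr0.
Qed.

(** The hyperbolic form built from the pairing; both cyclic spaces are isotropic
    for it. *)
Lemma form_cyc_pair n P Q u v : size P = n.+1 -> prefl P %= Q ->
  pact f P u = 0 -> pact f Q v = 0 ->
  \dim (cyc f n u) = n -> \dim (cyc f n v) = n ->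
  (cyc f n u :&: cyc f n v = 0)%VS ->
  has_invariant_form (cyc f n u + cyc f n v)%VS.
Proof.
move=> szP PQ Pu Qv dim_u dim_v cap0; have cap0' := cap0_sym cap0.
have szQ : size Q = n.+1 by rewrite -(eqp_size PQ) size_prefl.
have sU := cyc_stable szP Pu; have sW := cyc_stable szQ Qv.
set U := cyc f n u in cap0 cap0' sU *; set W := cyc f n v in cap0 cap0' sW *.
pose p1 := daddv_pi U W; pose p2 := daddv_pi W U.
pose t := cycpair n P u v.
have t0 x : t 0 x = 0.
  have := cycpair_linearl n P u v (-1) 0 0 x.
  by rewrite scaler0 addr0 mulN1r addNr.
have t0r x : t x 0 = 0.
  have := cycpair_linearr n P u v (-1) x 0 0.
  by rewrite scaler0 addr0 mulN1r addNr.
exists (fun x y => t (p1 x) (p2 y) - t (p1 y) (p2 x)); split.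
- move=> a x1 x2 y; rewrite /t !linearP cycpair_linearl cycpair_linearr.
  by rewrite opprD addrACA -mulrBr.
- by move=> x y; rewrite opprB.
- move=> x y xUW yUW; rewrite /p1 /p2 !pi_stable // 1?addvC //.
  have inv := cycpair_invariant szP PQ Pu Qv dim_u dim_v.
  by rewrite addrACA inv ?memv_pi // add0r -opprD addrC inv ?memv_pi // oppr0.
move=> _ /memv_addP[y yU [z zW ->]] xo.
have y0 : y = 0.
  apply: (cycpair_nondegl szP PQ Pu Qv dim_u dim_v yU) => w wW.
  have := xo w (subvP (addvSr _ _) _ wW).
  rewrite /p1 /p2 !linearD /= (daddv_pi_id cap0 yU) (pi_other cap0 zW).
  by rewrite (daddv_pi_id cap0' wW) (pi_other cap0 wW) t0 subr0 addr0.
have z0 : z = 0.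
  apply: (cycpair_nondegr szP PQ Pu Qv dim_u dim_v zW) => w wU.
  have := xo w (subvP (addvSl _ _) _ wU).
  rewrite /p1 /p2 !linearD /= (pi_other cap0' wU) t0r sub0r.
  rewrite (daddv_pi_id cap0' zW) (pi_other cap0' yU) (daddv_pi_id cap0 wU).
  by rewrite add0r => /eqP; rewrite oppr_eq0 => /eqP.
by rewrite y0 z0 addr0.
Qed.

Lemma form_selfdual_cyc n P u :
  size P = n.+1 -> prefl P %= P -> (0 < n)%N -> ~~ odd n ->
  pact f P u = 0 -> \dim (cyc f n u) = n -> has_invariant_form (cyc f n u).
Proof.
move=> szP selfP n_gt0 n_even Pu dim_u.
exists (cycpair n P u u); split.
- exact: cycpair_linearl.
- move=> x y; rewrite /cycpair -(residue_prefl _ selfP) // rmorphM /= preflK.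
  by rewrite mulrC.
- move=> x y xu yu; exact: (cycpair_invariant szP selfP Pu Pu).
- move=> x xu; exact: (cycpair_nondegl szP selfP Pu Pu).
Qed.

End CyclicForms.

(** * From balanced blocks to an invariant symplectic form *)

Section BalancedMore.
Variable F : fieldType.
Implicit Types (s : seq (jblock F)) (B : jblock F).

Lemma balanced_cancel s1 s2 : balanced (s1 ++ s2) -> balanced s1 -> balanced s2.
Proof.
move=> [r c n] [r1 c1 n1]; split=> [m l l0|m a b a0 b0|m om].
- have := r m l l0; rewrite !mult_real_cat (r1 m l l0).
  by move/eqP; rewrite eqn_add2l => /eqP.
- have := c m a b a0 b0; rewrite !mult_complex_cat (c1 m a b a0 b0).
  by move/eqP; rewrite eqn_add2l => /eqP.
- by have := n m om; rewrite mult_real_cat oddD (negPf (n1 m om)).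
Qed.

Lemma balanced_count s1 s2 :
  (forall p, count p s1 = count p s2) -> balanced s1 -> balanced s2.
Proof.
move=> eq_c [r c n]; split=> [m l l0|m a b a0 b0|m om].
- by rewrite /mult_real -!eq_c; apply: r.
- by rewrite /mult_complex -!eq_c; apply: c.
- by rewrite /mult_real -eq_c; apply: n.
Qed.

Lemma has_split (T : Type) (p : pred T) (t : seq T) : has p t ->
  exists t1 x t2, p x /\ t = t1 ++ x :: t2.
Proof.
elim: t => //= x t IH; have [px _|_ /= /IH[t1 [y [t2 [py ->]]]]] := boolP (p x).
  by exists [::], x, t.
by exists (x :: t1), y, t2.
Qed.

End BalancedMore.

Section FormOfBlocks.
Variables (R : rcfType) (V : vectType R) (f : 'End(V)).
Implicit Types (x y : jblock R * V) (t : seq (jblock R * V)) (U W : {vspace V}).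

Lemma decomposes_swap t1 x t2 U :
  decomposes f (t1 ++ x :: t2) U -> decomposes f (x :: t1 ++ t2) U.
Proof.
move=> [bt sum_t dim_t]; split.
- by move: bt; rewrite /= !all_cat /= andbCA.
- rewrite -sum_t big_cons !big_cat big_cons /= addvA.
  by rewrite [(block_span _ _ + _)%VS]addvC -addvA.
- by rewrite dim_t big_cons !big_cat big_cons /= addnCA.
Qed.

Lemma dim_sum_block_span t :
  (\dim (\sum_(x <- t) block_span f x) <= \sum_(x <- t) jblock_dim x.1)%N.
Proof.
elim: t => [|x t IH]; first by rewrite !big_nil dimv0.
by rewrite !big_cons (leq_trans (dimv_add_leqif _ _)) // leq_add // dim_cyc_le.
Qed.

Lemma decomposes_cons x t U : decomposes f (x :: t) U ->
  exists W, [/\ is_block f x, decomposes f t W, (block_span f x :&: W = 0)%VS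
    & U = (block_span f x + W)%VS].
Proof.
case=> /= /andP[bx bt] sum_t dim_t; exists (\sum_(y <- t) block_span f y)%VS.
have dim_x : \dim (block_span f x) = jblock_dim x.1.
  by case/and3P: bx => _ _ /eqP.
have le_t := dim_sum_block_span t.
move: sum_t dim_t; rewrite !big_cons => <- dim_t.
have := dimv_sum_cap (block_span f x) (\sum_(y <- t) block_span f y).
rewrite dim_t dim_x => cap_dim.
have arith (c d n e : nat) : (d <= n -> e + n + c = e + d -> c = 0 /\ d = n)%N.
  by lia.
have [cap0 dim_W] := arith _ _ _ _ le_t cap_dim.
by split=> //; apply/eqP; rewrite -dimv_eq0 cap0.
Qed.

Definition dual_blocks (B B' : jblock R) : Prop :=
  prefl (block_poly B) %= block_poly B' /\ jblock_dim B' = jblock_dim B.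

Lemma form_pair x y : is_block f x -> is_block f y -> dual_blocks x.1 y.1 ->
  (block_span f x :&: block_span f y = 0)%VS ->
  has_invariant_form f (block_span f x + block_span f y)%VS.
Proof.
case: x y => [B u] [B' v].
case/and3P=> [_ /eqP pu /eqP du] /and3P[_ /eqP pv /eqP dv] /=.
case=> dual dimE; move: dv; rewrite /block_span /= dimE => dv cap0.
exact: (form_cyc_pair (size_block_poly B) dual pu pv du dv cap0).
Qed.

Lemma form_single x :
  is_block f x -> prefl (block_poly x.1) %= block_poly x.1 ->
  ~~ odd (jblock_dim x.1) -> has_invariant_form f (block_span f x).
Proof.
case: x => B u /and3P[wfB /eqP pu /eqP du] /= dual even.
apply: (form_selfdual_cyc (size_block_poly B) dual _ even pu du).
case: B wfB {pu du dual even} => [m l|m a b] //= /andP[m_gt0 _].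
by rewrite sum_nat_const card_ord muln_gt0 m_gt0.
Qed.

Lemma dual_real m (l : R) : dual_blocks (JReal m l) (JReal m (- l)).
Proof.
split=> //; rewrite /block_poly rmorphXn eqp_exp //=.
rewrite -/(block_factor (JReal m l)).
by rewrite prefl_linear -scaleN1r eqp_scale // oppr_eq0 oner_neq0.
Qed.

Lemma dual_complex m (a b b' : R) : (b' == b) || (b' == - b) ->
  dual_blocks (JComplex m a b) (JComplex m (- a) b').
Proof.
move=> bb'; split=> //; rewrite /block_poly rmorphXn eqp_exp //=.
rewrite -/(block_factor (JComplex m a b)) prefl_quad /=.
by case/pred2P: bb' => ->; rewrite ?sqrrN eqpxx.
Qed.

(** By (a), (b) or the parity condition (c), a block that is not self-dual of
    even dimension has a dual block among the remaining ones.  The partner is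
    given through a predicate because [mult_complex] counts blocks whose
    parameter b is determined up to sign only. *)
Lemma balanced_partner B (s : seq (jblock R)) :
  jblock_wf B -> balanced (B :: s) ->
  [/\ balanced [:: B], prefl (block_poly B) %= block_poly B
    & ~~ odd (jblock_dim B)]
  \/ exists p : pred (jblock R), has p s /\
       forall B', p B' -> balanced [:: B; B'] /\ dual_blocks B B'.
Proof.
case: B => [m l|m a b] /= wfB [r c n].
  have [l0|l0] := eqVneq l 0.
    have [m_odd|m_even] := boolP (odd m); last first.
      left; rewrite l0; split=> //; first exact: balanced_real0.
      by have [] := dual_real m 0; rewrite oppr0.
    right; exists (fun B =>
      if B is JReal m' l' then (m' == m) && (l' == l) else false).
    split.
      have := n m m_odd; rewrite /mult_real /= l0 !eqxx addSn add0n oddS negbK.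
      by rewrite has_count; case: count.
    case=> // m' l' /andP[/eqP-> /eqP->]; rewrite l0.
    have := balanced_real m (0 : R); have := dual_real m 0.
    by rewrite oppr0; split.
  right; exists (fun B =>
    if B is JReal m' l' then (m' == m) && (l' == - l) else false).
  split; last first.
    case=> // m' l' /andP[/eqP-> /eqP->].
    by split; [apply: balanced_real|apply: dual_real].
  have := r m l l0; rewrite /mult_real /= !eqxx has_count /=.
  by rewrite -addr_eq0 -mulr2n mulrn_eq0 /= (negPf l0) !add0n => <-.
case/andP: wfB => _ b0; have [a0|a0] := eqVneq a 0.
  left; rewrite a0; split; first exact: balanced_complex0.
    by have [|] := @dual_complex m 0 b b; rewrite ?eqxx // oppr0.
  by rewrite sum_nat_const card_ord muln2 odd_double.
right; exists (fun B => if B is JComplex m' a' b'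
    then [&& m' == m, a' == - a & (b' == b) || (b' == - b)] else false).
split; last first.
  case=> // m' a' b' /and3P[/eqP-> /eqP-> bb'].
  by split; [apply: balanced_complex|apply: dual_complex].
have := c m a b a0 b0; rewrite /mult_complex /= !eqxx has_count /=.
by rewrite -addr_eq0 -mulr2n mulrn_eq0 /= (negPf a0) !add0n => <-.
Qed.

(** The list is consumed block by block: the first one is treated alone or
    together with a partner, and the rest remains balanced. *)
Lemma form_of_balanced t U : decomposes f t U -> balanced (map fst t) ->
  has_invariant_form f U.
Proof.
have [n] := ubnP (size t); elim: n t U => // n IH [|x t] U /= lt_n.
  by case=> _ <- _ _; rewrite big_nil; apply: form_zero.
case/decomposes_cons=> W [bx dW cap0 ->] bal.
have sW : stable f W by have [bt <- _] := dW; apply: sum_block_span_stable.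
have sx := block_span_stable bx; have wfx : jblock_wf x.1 by case/and3P: bx.
case: (balanced_partner wfx bal) => [[bal1 dual even]|[p [has_p pP]]].
  apply: form_sum => //; first exact: form_single.
  by apply: (IH t) => //; apply: (@balanced_cancel _ [:: x.1]) bal bal1.
have : has (fun y => p y.1) t by rewrite -(has_map fst p).
case/has_split=> t1 [y [t2 [py def_t]]].
rewrite def_t in dW bal lt_n.
have /decomposes_cons[W' [bfy dW' cap0' defW]] := decomposes_swap dW.
have [bal2 dual] := pP _ py.
have sy := block_span_stable bfy.
have sW' : stable f W' by have [bt <- _] := dW'; apply: sum_block_span_stable.
have capxy : (block_span f x :&: block_span f y = 0)%VS.
  by apply/eqP; rewrite -subv0 -cap0 capvS // defW addvSl.
rewrite defW addvA; apply: form_sum => //.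
- apply/eqP; rewrite -dimv_eq0.
  have dim_xy := dimv_disjoint_sum capxy.
  have dim_W : \dim W = (\dim (block_span f y) + \dim W')%N.
    by rewrite defW dimv_disjoint_sum.
  have := dimv_sum_cap (block_span f x + block_span f y) W'.
  rewrite -addvA -defW.
  rewrite dimv_disjoint_sum // dim_xy dim_W addnA -[RHS]addn0 => /eqP.
  by rewrite eqn_add2l.
- exact: stableD.
- exact: form_pair.
apply: (IH (t1 ++ t2)) => //.
  by move: lt_n; rewrite !size_cat /=; lia.
have {}bal : balanced ([:: x.1; y.1] ++ map fst (t1 ++ t2)).
  apply: balanced_count bal => q.
  by rewrite /= !map_cat !count_cat /= [(count q _ + (_ + _))%N]addnCA.
exact: balanced_cancel bal bal2.
Qed.

End FormOfBlocks.

(** * Closed 2-forms on the almost abelian Lie algebra *)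

Lemma skew_form (F : fieldType) (V : vectType F) (g : V -> V -> F) :
  (forall a x1 x2 y, g (a *: x1 + x2) y = a * g x1 y + g x2 y) ->
  (forall x y, g x y = - g y x) ->
  exists sg : {skew_symmetric V}, forall x y, sg x y = g x y.
Proof.
move=> lin sk.
have bil : bilinear_for *%R (idfun \; *%R) g.
  split=> [y a x1 x2|x a y1 y2] /=; first by rewrite lin.
  by rewrite sk lin opprD -mulrN -sk -sk.
have herm x y : g x y = (-1) ^+ true * idfun (g y x).
  by rewrite expr1 mulN1r sk.
pose b := bilinear_isBilinear.Build F V V F *%R (idfun \; *%R) g bil.
pose h := isHermitianSesquilinear.Build F V true idfun g herm.
by exists (HB.pack_for {skew_symmetric V} g b h).
Qed.

Section Extension.
Variables (R : fieldType) (h : vectType R) (A : 'End(h)) (hc hs : {vspace h}).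
Hypotheses (h_sum : (hc + hs)%VS = fullv) (cap0 : (hs :&: hc = 0)%VS).
Hypotheses (hc_inv : (A @: hc <= hc)%VS) (hs_inv : (A @: hs <= hs)%VS).

(** On e_0 and two vectors of the abelian ideal only two of the three terms of
    the differential survive. *)
Lemma closed_invariant (omega : {skew_symmetric (almost_abelian h)}) u v :
  ce_closed A omega ->
  omega (aa_ideal (A u)) (aa_ideal v) + omega (aa_ideal u) (aa_ideal (A v)) = 0.
Proof.
move=> /(_ (aa_e0 h) (aa_ideal u) (aa_ideal v)).
rewrite /ce_d2 !aa_bracket_e0 aa_bracket_abelian linear0l subr0.
rewrite [omega (aa_ideal (A v)) _]skewC -opprD => /eqP.
by rewrite oppr_eq0 => /eqP.
Qed.

(** The projection onto h_s along R e_0 + h_c. *)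
Definition proj_s (X : almost_abelian h) : subvs_of hs :=
  vsproj hs (daddv_pi hs hc X.2).

Fact proj_s_is_linear : linear proj_s.
Proof. by move=> a X Y; rewrite /proj_s /= !linearP. Qed.
HB.instance Definition _ := GRing.isLinear.Build R (almost_abelian h)
  (subvs_of hs) *:%R proj_s proj_s_is_linear.

Lemma proj_s_ideal (u : subvs_of hs) : proj_s (aa_ideal (vsval u)) = u.
Proof. by rewrite /proj_s /= daddv_pi_id ?subvsP // vsvalK. Qed.

Lemma proj_s_bracket X Y : proj_s (aa_bracket A X Y) =
  X.1 *: restr_end A hs (proj_s Y) - Y.1 *: restr_end A hs (proj_s X).
Proof.
have com w : daddv_pi hs hc (A w) = A (daddv_pi hs hc w).
  apply: pi_stable => //; [exact/limg_stable|exact/limg_stable|].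
  by rewrite addvC h_sum memvf.
apply: subvs_inj; rewrite linearB !linearZ /= !restr_endE //.
rewrite !vsprojK ?memv_pi // -!com.
by rewrite linearB !linearZ.
Qed.

(** By invariance sigma(Bx, y) is symmetric in x and y for B = A_s, so the six
    terms of the differential cancel in pairs. *)
Lemma pullback_closed (s : {skew_symmetric (subvs_of hs)})
    (omega : {skew_symmetric (almost_abelian h)}) :
  (forall X Y, omega X Y = s (proj_s X) (proj_s Y)) ->
  in_sp s (restr_end A hs) -> ce_closed A omega.
Proof.
move=> omegaE sp X Y Z; rewrite /ce_d2 !omegaE !proj_s_bracket.
set B := restr_end A hs.
set x := proj_s X; set y := proj_s Y; set z := proj_s Z.
have sym u v : s (B u) v = s (B v) u.
  by apply/eqP; rewrite -subr_eq0 [s (B v) u]skewC opprK sp.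
rewrite !linearBl !linearZl_LR /= (sym z y) (sym z x) (sym y x).
by ring.
Qed.

End Extension.

Theorem proposition3p15 (R : realType) (n k : nat) (h : vectType R)
    (A : 'End(h)) (hc hs : {vspace h})
    (dim_h : \dim {:h} = (2 * n - 1)%N)
    (k_ge1 : (1 <= k)%N) (k_le_n : (k <= n)%N)
    (h_sum : (hc + hs)%VS = fullv) (h_direct : directv (hc + hs))
    (hc_inv : (A @: hc <= hc)%VS) (hs_inv : (A @: hs <= hs)%VS)
    (dim_hs : \dim hs = (2 * (n - k))%N) :
  let As := restr_end A hs in
  [<->
    exists omega : {skew_symmetric (almost_abelian h)},
      ce_closed A omega /\ nondegenerate (restr_form omega (W := hs));
    exists sigma : {skew_symmetric (subvs_of hs)},
      is_psymplectic sigma /\ in_sp sigma As;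
    exists s : seq (jblock R),
      [/\ real_jordan_form As s,
          forall (m : nat) (lambda : R), lambda != 0 ->
            mult_real s m lambda = mult_real s m (- lambda),
          forall (m : nat) (a b : R), a != 0 -> b != 0 ->
            mult_complex s m a b = mult_complex s m (- a) b
        & forall m : nat, odd m -> ~~ odd (mult_real s m 0)]].
Proof.
move=> As; have two_neq0 : (2 : R) != 0 by rewrite pnatr_eq0.
have cap0 : (hs :&: hc = 0)%VS by rewrite capvC; apply/directv_addP.
tfae.
- case=> omega [clo nd]; exists (restr_form omega (W := hs)); split.
    by split=> //; rewrite inE /= (negPf two_neq0).
  move=> u v; rewrite /= /restr_form /As !restr_endE //.
  exact: closed_invariant.
- case=> sg [[nd _ _] sp].
  have nF : nondeg sg fullv by rewrite /nondeg capfv; apply/eqP.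
  have sF : stable As fullv by move=> x _; apply: memvf.
  have [t dt [r c p]] := nondeg_decomposition sp sF nF.
  exists (map fst t); split=> //.
  exact: decomposes_jordan_form.
case=> s [jf r c p].
have [t def_s dt] := jordan_form_decomposes two_neq0 jf.
have bal : balanced (map fst t) by rewrite def_s.
have [g [lin sk inv nd]] := form_of_balanced dt bal.
have [sg sgE] := skew_form lin sk.
have [||omega omegaE] := @skew_form _ (almost_abelian h)
    (fun X Y => sg (proj_s hc hs X) (proj_s hc hs Y)).
- by move=> a X1 X2 Y; rewrite linearP linearPl.
- by move=> X Y; apply: skewC.
exists omega; split.
  apply: (pullback_closed h_sum cap0 hc_inv hs_inv omegaE) => u v.
  by rewrite !sgE inv ?memvf.
rewrite /nondegenerate -subv0; apply/subvP => u /mem_orthovP uo.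
rewrite memv0; apply/eqP; apply: nd => [|v _]; first exact: memvf.
have := uo v (memvf v).
by rewrite /= /restr_form omegaE !proj_s_ideal // sgE.
Qed.
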